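(* An orientation of the four-cycle $C_4$ is avoidable if and only if it admits no height function. Equivalently, among the four orientations $\vec C_4$, $C_4^{(1,3)}$, $C_4^{(2,2)}$, $\vec K_{2,2}$ of $C_4$ (all orientations up to isomorphism), precisely $\vec C_4$ and $C_4^{(1,3)}$ are avoidable.
   Context: All digraphs are finite and loopless, with no parallel arcs; digons (pairs of oppositely directed arcs between two vertices) are allowed. A height function on a digraph $F$ is a map $h:V(F)\to\mathbb Z$ such that $h(v)=h(u)+1$ for every arc $u\to v$ of $F$. A digraph is $F$-free if it has no (not necessarily induced) subdigraph isomorphic to $F$. A digraph $F$ is avoidable if, for every positive integer $k$, there exists an integer $d$ such that every (nonempty) digraph of minimum out-degree at least $d$ contains a (nonempty) $F$-free subdigraph of minimum out-degree at least $k$. Up to isomorphism there are four orientations of the undirected 4-cycle $C_4$; on the vertex set $\{a,b,c,d\}$ their arc sets are: $A(\vec C_4)=\{a\to b,\ b\to c,\ c\to d,\ d\to a\}$; $A(C_4^{(1,3)})=\{a\to b,\ b\to c,\ c\to d,\ a\to d\}$; $A(C_4^{(2,2)})=\{a\to b,\ a\to d,\ b\to c,\ d\to c\}$; $A(\vec K_{2,2})=\{a\to b,\ a\to d,\ c\to b,\ c\to d\}$. *)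

(* Defs.v *)
From mathcomp Require Import all_boot all_order all_algebra.

Set Implicit Arguments.
Unset Strict Implicit.
Unset Printing Implicit Defensive.

Import GRing.Theory.

Record digraph := Digraph {
  vertex :> finType;
  arc : rel vertex;
  arc_irr : irreflexive arc
}.

Definition diso (F G : digraph) : Prop :=
  exists f : F -> G, bijective f /\ forall u v, arc (f u) (f v) = arc u v.

Record subdigraph (D : digraph) := Subdigraph {
  sub_vertices : {set D};
  sub_arcs : {set D * D};
  sub_arcsP : forall u v, (u, v) \in sub_arcs ->
    [/\ arc u v, u \in sub_vertices & v \in sub_vertices]
}.

Section DigraphOfSub.
Variables (D : digraph) (H : subdigraph D).

Definition sub_arc : rel {u : D | u \in sub_vertices H} :=
  fun u v => (val u, val v) \in sub_arcs H.

Lemma sub_arc_irr : irreflexive sub_arc.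
Proof.
move=> u; apply/negP => /sub_arcsP[uu _ _].
by rewrite arc_irr in uu.
Qed.

Definition digraph_of_sub : digraph := Digraph sub_arc_irr.

End DigraphOfSub.

Coercion digraph_of_sub : subdigraph >-> digraph.

Definition free (F D : digraph) : Prop := forall H : subdigraph D, ~ diso F H.

Definition outdeg (D : digraph) (u : D) : nat := #|[set v | arc u v]|.

(* Vacuous when D has no vertex: nonemptiness is required separately. *)
Definition min_outdeg_ge (d : nat) (D : digraph) : Prop :=
  forall u : D, d <= outdeg u.

Definition nonempty (D : digraph) : Prop := 0 < #|D|.

Definition avoidable (F : digraph) : Prop :=
  forall k : nat, 0 < k ->
  exists d : nat, forall D : digraph, nonempty D -> min_outdeg_ge d D ->
  exists H : subdigraph D, [/\ nonempty H, free F H & min_outdeg_ge k H].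

Definition height_function (F : digraph) (h : F -> int) : Prop :=
  forall u v : F, arc u v -> h v = (h u + 1)%R.

(* F is, up to renaming its vertices, an orientation of the simple graph with
   adjacency relation g: each edge carries exactly one of its two arcs. *)
Definition orientation_of (T : finType) (g : rel T) (F : digraph) : Prop :=
  exists f : F -> T, bijective f /\
    forall u v, (g (f u) (f v) = arc u v || arc v u) /\ ~~ (arc u v && arc v u).

(* [ordS] is the cyclic successor on ['I_4]. *)
Definition C4 : rel 'I_4 := fun i j => (j == ordS i) || (i == ordS j).

Definition arcs4 (s : seq (nat * nat)) : rel 'I_4 :=
  fun i j => (val i, val j) \in s.

Lemma arcs4_irr s : all (fun p => p.1 != p.2) s -> irreflexive (arcs4 s).
Proof.
move=> /allP s_ok i; apply/negP => /s_ok.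
by rewrite /= eqxx.
Qed.

(* In the four digraphs below the vertices a, b, c, d are 0, 1, 2, 3. *)
Definition C4_directed : digraph :=
  Digraph (@arcs4_irr [:: (0, 1); (1, 2); (2, 3); (3, 0)] isT).

Definition C4_13 : digraph :=
  Digraph (@arcs4_irr [:: (0, 1); (1, 2); (2, 3); (0, 3)] isT).

Definition C4_22 : digraph :=
  Digraph (@arcs4_irr [:: (0, 1); (0, 3); (1, 2); (3, 2)] isT).

Definition K22_directed : digraph :=
  Digraph (@arcs4_irr [:: (0, 1); (0, 3); (2, 1); (2, 3)] isT).

Definition C4_orientation (i : 'I_4) : digraph :=
  match val i with
  | 0 => C4_directed
  | 1 => C4_13
  | 2 => C4_22
  | _ => K22_directed
  end.

(* Main.v *)
From Pilot Require Import Defs.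
From mathcomp Require Import all_boot all_order all_algebra.
From mathcomp Require Import zify.
(* [path.arc] would otherwise hide the arcs of a digraph. *)
Import Pilot.Defs.

Set Implicit Arguments.
Unset Strict Implicit.
Unset Printing Implicit Defensive.

(** Unavoidable orientations. The two orientations with a height function are
    both contained in the digraph with arcs from [l] to [b], [b'] and from each
    of [b], [b'] to both [c], [c']. A digraph of out-degree at least [n] that
    forces this pattern in all its subdigraphs of minimum out-degree 2 is
    obtained by letting the vertices anticipate the choices made by the
    subdigraph. Take a set of [n] vertices [c] and a large set of vertices [b],
    each sending arcs to all [c]. A subdigraph of out-degree 2 determines a
    colouring [chi] of the [b]'s by pairs of [c]'s. Add a vertex for each set
    [W] of such colourings; it is joined to the sets obtained from [W] by
    deleting one colouring, hence at most one out-neighbour of [W] misses a given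
    [chi] of [W], and the subdigraph can always be followed to a set that still
    contains its own [chi]. Once [W] has fewer than [n] elements, the pigeonhole
    principle gives [n] vertices [b] on which all elements of [W] are constant,
    and [W] is joined to these; two of them are kept, and they keep the same pair
    of [c]'s (lemma [forced_pattern]).

    Avoidable orientations. Given [N v], a set of exactly [d] out-neighbours of
    each [v], subsets [T v] of size at least [k] are to be chosen so that the
    arcs from [v] to [T v] contain no copy of the orientation. In-degrees are not
    bounded, so choosing at random and applying a local lemma is in general not
    possible. For the directed cycle it is: a vertex lies on at most [d ^ 3]
    directed 4-cycles, and if [N v] is cut into [g] parts, one of which is
    selected, a cycle survives with probability [g ^- 4]. The local lemma is
    replaced by a counting induction (lemma [partial_grow]).

    For the transitive orientation, with arcs from [a] to [b], from [b] to [c],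
    from [c] to [d] and from [a] to [d], fix an order in which every vertex has at
    most [d] earlier in-neighbours, and let each vertex keep either its arcs to
    later vertices or its arcs to earlier ones, whichever are more numerous. The
    kept arcs that go up have bounded in-degree, the kept arcs that go down form
    an acyclic digraph. Let each vertex moreover choose the direction used by
    its out-neighbours, so that [b] and [d], which are both in [T a], always use
    the same direction. There remain three cases.
    - If [b] and [c] use the same direction, then [b], [c], [d] lie on a monotone
      path. Colours with two values, chosen along the order and constant on each
      [T a], make [d] differ from [b] (lemmas [acyclic_colouring] and
      [oriented_selection]).
    - If [b] goes up and [c] goes down, colours must make [d] differ from [b]
      although [d] and [b] are not comparable. A majority colouring ensures that
      for most [c] the colour of [b] is rare in [N c]. By Hall's theorem the
      vertices [b] can select such [c] with a bounded number of them selecting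
      the same [c]; so [c] can avoid the colours of all of them (lemma
      [up_down_selection]).
    - If [b] goes down and [c] goes up, the selection of [c] has just been fixed.
      If [a] goes up, the bounds on the in-degrees leave only few [c] that [b] has
      to avoid; if [a] goes down, [T a] is taken to be an independent set for the
      relation that joins [b] to [d] (lemma [C4_13_selection]). *)

(** * Counting *)

Lemma subset_of_card (T : finType) (A : {set T}) m :
  m <= #|A| -> exists2 B : {set T}, B \subset A & #|B| = m.
Proof.
move=> /card_geqP[s [us ss sA]].
exists [set x in s]; first by apply/subsetP => x; rewrite !inE => /sA.
by rewrite cardsE (card_uniqP us).
Qed.

Lemma leq_card_bigcup (I T : finType) (A : {set I}) (F : I -> {set T}) :
  #|\bigcup_(i in A) F i| <= \sum_(i in A) #|F i|.
Proof.
elim/big_rec2: _ => [|i n B _ Bn]; first by rewrite cards0.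
by apply: leq_trans (leq_card_setU _ _) _; rewrite leq_add2l.
Qed.

Lemma light_class (T C : finType) (f : T -> C) (Q : pred T) (w : T -> nat) : 0 < #|C| ->
  exists c, #|C| * \sum_(x | Q x && (f x == c)) w x <= \sum_(x | Q x) w x.
Proof.
move=> C0; apply/existsP; apply: contraT => /existsPn heavy.
pose W := \sum_(x | Q x) w x; have /card_gt0P[c0 _] := C0.
have : \sum_(c : C) W < \sum_(c : C) #|C| * \sum_(x | Q x && (f x == c)) w x.
  have lt c : W < #|C| * \sum_(x | Q x && (f x == c)) w x by rewrite ltnNge heavy.
  rewrite (bigD1 c0) //= [ltnRHS](bigD1 c0) //= -addSn; apply: leq_add; first exact: lt.
  by apply: leq_sum => c _; apply: ltnW; apply: lt.
by rewrite -big_distrr /= -(partition_big f predT) //= sum_nat_const ltnn.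
Qed.

Lemma popular (T C : finType) (f : T -> C) (A : {set T}) : 0 < #|C| ->
  exists c, #|A| <= #|C| * #|[set x in A | f x == c]|.
Proof.
move=> C0; apply/existsP; apply: contraT => /existsPn few.
have /card_gt0P[c0 _] := C0.
have : \sum_(c : C) #|C| * #|[set x in A | f x == c]| < \sum_(c : C) #|A|.
  have lt c : #|C| * #|[set x in A | f x == c]| < #|A| by rewrite ltnNge few.
  rewrite (bigD1 c0) //= [ltnRHS](bigD1 c0) //= -addSn; apply: leq_add; first exact: lt.
  by apply: leq_sum => c _; apply: ltnW; apply: lt.
rewrite -big_distrr /= (eq_bigr (fun c => \sum_(x in A | f x == c) 1)) => [|c _].
  by rewrite -(partition_big f predT) //= sum1_card sum_nat_const ltnn.
by rewrite sum1dep_card.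
Qed.

(** The position of [x] in the enumeration of [A], divided by [k], tells the part
    that contains [x]. *)
Lemma chunks (T : finType) (A : {set T}) g k : 0 < g -> g * k <= #|A| ->
  exists f : T -> 'I_g, forall i, k <= #|[set x in A | f x == i]|.
Proof.
case: g => // g _ gkA; have [->|k0] := posnP k; first by exists (fun=> ord0).
have [x0 _] : exists x, x \in A.
  by apply/card_gt0P; apply: leq_trans gkA; rewrite muln_gt0 k0.
exists (fun x => inord (index x (enum A) %/ k)) => i.
pose e (j : 'I_k) := nth x0 (enum A) (i * k + j).
have ltA (j : 'I_k) : i * k + j < size (enum A).
  rewrite -cardE; apply: leq_trans gkA; apply: (@leq_trans (i.+1 * k)).
    by rewrite mulSnr ltn_add2l.
  by rewrite leq_mul2r ltn_ord orbT.
have e_inj : injective e.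
  by move=> j j' /eqP; rewrite nth_uniq ?enum_uniq ?ltA // eqn_add2l => /eqP/val_inj.
rewrite -{1}(card_ord k) -(card_codom e_inj); apply: subset_leq_card.
apply/subsetP => _ /codomP[j ->]; rewrite inE -mem_enum mem_nth ?ltA //=.
rewrite index_uniq ?enum_uniq ?ltA //; apply/eqP/val_inj; rewrite /= divnMDl //.
by rewrite divn_small ?ltn_ord // addn0 inordK.
Qed.

(** * Embeddings, isomorphisms and avoidability *)

Definition embeds (F G : digraph) : Prop :=
  exists f : F -> G, injective f /\ forall u v, arc u v -> arc (f u) (f v).

Lemma embeds_not_free (F G : digraph) : embeds F G -> ~ free F G.
Proof.
move=> [f [f_inj f_arc]].
pose VV := [set f x | x : F].
pose AA := [set p : G * G | [exists u, exists v, arc u v && (p == (f u, f v))]].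
have AAP u v : (u, v) \in AA -> [/\ arc u v, u \in VV & v \in VV].
  rewrite inE => /existsP[x /existsP[y /andP[xy /eqP[-> ->]]]].
  by split; [exact: f_arc | exact: imset_f | exact: imset_f].
move=> /(_ (Subdigraph AAP)); apply.
have fV x : f x \in VV by exact: imset_f.
exists (fun x => exist _ (f x) (fV x)); split; last first.
  move=> u v; rewrite /arc /= /sub_arc /= inE.
  apply/existsP/idP => [[x /existsP[y /andP[xy /eqP[/f_inj-> /f_inj->]]]]//|uv].
  by exists u; apply/existsP; exists v; rewrite eqxx andbT.
apply: inj_card_bij => [x y /(congr1 val) /f_inj//|].
rewrite card_sig (_ : #|_| = #|VV|); first by rewrite card_imset.
by apply: eq_card => x; rewrite inE.
Qed.

Lemma not_embeds_free (F G : digraph) : ~ embeds F G -> free F G.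
Proof.
move=> noemb H [f [f_bij f_arc]]; apply: noemb.
exists (fun x => val (f x)); split; first by move=> x y /val_inj /(bij_inj f_bij).
move=> u v; rewrite -f_arc => uv.
by have [] := sub_arcsP uv.
Qed.

Lemma diso_sym F G : diso F G -> diso G F.
Proof.
move=> [f [[g fK gK] f_arc]]; exists g; split; first by exists f.
by move=> u v; rewrite -f_arc !gK.
Qed.

Lemma diso_trans F G K : diso F G -> diso G K -> diso F K.
Proof.
move=> [f [f_bij f_arc]] [g [g_bij g_arc]]; exists (g \o f); split.
  exact: bij_comp.
by move=> u v; rewrite /= g_arc f_arc.
Qed.

Lemma avoidable_diso F G : diso F G -> avoidable F -> avoidable G.
Proof.
move=> isoFG avF k /avF[d hd]; exists d => D D0 /(hd D D0)[H [H0 frH kH]].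
exists H; split=> // K isoK; exact: (frH K (diso_trans isoFG isoK)).
Qed.

Section Selection.
Variables (D : digraph) (T : D -> {set D}).
Hypothesis T_arc : forall u v, v \in T u -> arc u v.

Let arcs := [set p : D * D | p.2 \in T p.1].

Let arcsP u v : (u, v) \in arcs -> [/\ arc u v, u \in [set: D] & v \in [set: D]].
Proof. by rewrite inE /= => /T_arc; rewrite !inE. Qed.

Definition selection : subdigraph D := Subdigraph arcsP.

Lemma selection_nonempty : nonempty D -> nonempty selection.
Proof.
rewrite /nonempty => /card_gt0P[x _]; apply/card_gt0P.
by exists (exist _ x (in_setT x)).
Qed.

Lemma selection_outdeg k : (forall v, k <= #|T v|) -> min_outdeg_ge k selection.
Proof.
move=> kT u; apply: leq_trans (kT (val u)) _.
rewrite /outdeg -(card_imset _ val_inj); apply: subset_leq_card.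
apply/subsetP => v vT; apply/imsetP; exists (exist _ v (in_setT v)) => //.
by rewrite inE /arc /= /sub_arc inE.
Qed.

Lemma selection_embeds F : embeds F selection ->
  exists f : F -> D, injective f /\ forall u v, arc u v -> f v \in T (f u).
Proof.
move=> [f [f_inj f_arc]]; exists (fun x => val (f x)); split.
  by move=> x y /val_inj /f_inj.
by move=> u v /f_arc; rewrite /arc /= /sub_arc inE.
Qed.

End Selection.

(** Making all out-degrees equal to [d] costs nothing, and it bounds the number of
    arcs inside any set of vertices, hence some in-degree in it. *)
Lemma avoidable_selection (F : digraph) :
  (forall k, 0 < k -> exists d, forall (V : finType) (N : V -> {set V}),
     (forall v, v \notin N v) -> (forall v, #|N v| = d) ->
     exists T : V -> {set V},
       [/\ forall v, T v \subset N v, forall v, k <= #|T v| &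
         ~ exists f : F -> V,
             injective f /\ forall u v, arc u v -> f v \in T (f u)]) ->
  avoidable F.
Proof.
move=> selF k k0; have [d hd] := selF k k0; exists d => D D0 degD.
have [N NP] : exists N : D -> {set D},
    forall v, (N v \subset [set u | arc v u]) /\ #|N v| = d.
  suff NP v : exists Nv : {set D}, Nv \subset [set u | arc v u] /\ #|Nv| = d.
    by have [N NP'] := fin_all_exists NP; exists N.
  by have [A sA cA] := subset_of_card (degD v); exists A.
have NI v : v \notin N v.
  by apply/negP => /(subsetP (NP v).1); rewrite inE arc_irr.
have [T [TN kT noF]] := hd D N NI (fun v => (NP v).2).
have T_arc u v : v \in T u -> arc u v.
  by move=> /(subsetP (TN u)) /(subsetP (NP u).1); rewrite inE.
exists (selection T_arc); split.
- exact: (selection_nonempty T_arc D0).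
- by apply: not_embeds_free => /selection_embeds /noF.
- exact: selection_outdeg.
Qed.

(** * The orientations with a height function are unavoidable *)

Lemma arcs4_embeds s (s_ok : all (fun p => p.1 != p.2) s) (G : digraph)
    (x0 x1 x2 x3 : G) (x := nth x0 [:: x0; x1; x2; x3]) :
  uniq [:: x0; x1; x2; x3] -> (forall p, p \in s -> arc (x p.1) (x p.2)) ->
  embeds (Digraph (arcs4_irr s_ok)) G.
Proof.
move=> x_uniq x_arc; exists (fun i : 'I_4 => x i); split.
  by move=> i j /eqP; rewrite nth_uniq ?ltn_ord // => /eqP/val_inj.
by move=> i j /x_arc.
Qed.

Section Forcing.
(* [n] is a successor so that default pairs and colourings exist. *)
Variable p : nat.
Let n := p.+1.
Let pairs := ('I_n * 'I_n)%type.
Let M := n * #|{ffun 'I_n -> pairs}|.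
Let colouring := {ffun 'I_M -> pairs}.

Definition constant_on (W : {set colouring}) (A : {set 'I_M}) :=
  [forall chi in W, forall b in A, forall b' in A, chi b == chi b'].

(** A vertex is classified by the list of its colours under the elements of [W],
    padded to length [n]; [M] is large enough for some class to have [n] members. *)
Lemma constant_set_exists (W : {set colouring}) : #|W| < n ->
  exists A : {set 'I_M}, (#|A| == n) && constant_on W A.
Proof.
move=> Wn.
pose sig (b : 'I_M) : {ffun 'I_n -> pairs} :=
  [ffun i : 'I_n => nth [ffun=> (ord0, ord0)] (enum W) i b].
have sig0 : 0 < #|{ffun 'I_n -> pairs}|.
  by apply/card_gt0P; exists [ffun=> (ord0, ord0)].
have [y yM] := popular sig [set: 'I_M] sig0.
have [A sA cA] : exists2 A : {set 'I_M},
    A \subset [set b in [set: 'I_M] | sig b == y] & #|A| = n.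
  apply: subset_of_card; rewrite -(leq_pmul2l sig0) mulnC.
  by apply: leq_trans yM; rewrite cardsT card_ord.
exists A; rewrite cA eqxx; apply/forall_inP => chi chiW.
have iW : index chi (enum W) < n.
  by apply: leq_trans Wn; rewrite ltnS ltnW // cardE index_mem mem_enum.
have chiE b : b \in A -> chi b = y (Ordinal iW).
  move=> /(subsetP sA); rewrite !inE => /eqP <-.
  by rewrite ffunE /= nth_index ?mem_enum.
by apply/forall_inP => b bA; apply/forall_inP => b' b'A; rewrite !chiE.
Qed.

Definition constant_set (W : {set colouring}) : {set 'I_M} :=
  odflt set0 [pick A : {set 'I_M} | (#|A| == n) && constant_on W A].

Lemma constant_setP (W : {set colouring}) : #|W| < n ->
  #|constant_set W| = n /\ constant_on W (constant_set W).
Proof.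
move=> /constant_set_exists[A AP]; rewrite /constant_set.
by case: pickP => [B /andP[/eqP]|/(_ A)]//; rewrite AP.
Qed.

Definition forcing_vertex := ({set colouring} + ('I_M + 'I_n))%type.

Definition forcing_arc : rel forcing_vertex := fun u v =>
  match u, v with
  | inl W, inl W' => (n <= #|W|) && [exists chi in W, W' == W :\ chi]
  | inl W, inr (inl b) => (#|W| < n) && (b \in constant_set W)
  | inr (inl _), inr (inr _) => true
  | inr (inr _), inl W => [exists chi, W == [set~ chi]]
  | _, _ => false
  end.

Lemma forcing_arc_irr : irreflexive forcing_arc.
Proof.
case=> [W|[b|c]] //=; apply/negP => /andP[_ /exists_inP[chi chiW /eqP WE]].
by rewrite WE !inE eqxx in chiW.
Qed.

Definition forcing_digraph := Digraph forcing_arc_irr.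

Lemma forcing_outdeg : min_outdeg_ge n forcing_digraph.
Proof.
move=> [W|[b|c]]; rewrite /outdeg.
- have [Wn|Wn] := ltnP #|W| n.
  + have [cW _] := constant_setP Wn; apply: (@leq_trans #|constant_set W|).
      by rewrite cW.
    rewrite -(card_imset (constant_set W) (f := fun b => inr (inl b) : forcing_vertex)).
      apply: subset_leq_card; apply/subsetP => _ /imsetP[b bW ->].
      by rewrite inE /arc /= Wn.
    by move=> b b' [].
  + apply: (leq_trans Wn).
    have inj : {in W &, injective (fun chi => inl (W :\ chi) : forcing_vertex)}.
      move=> chi chi' chiW chi'W [/setP/(_ chi)]; rewrite !inE eqxx chiW /= andbT.
        by case: eqVneq.
    rewrite -(card_in_imset inj); apply: subset_leq_card.
    apply/subsetP => _ /imsetP[chi chiW ->]; rewrite inE /arc /= Wn.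
    by apply/exists_inP; exists chi.
- apply: (@leq_trans #|[set: 'I_n]|); first by rewrite cardsT card_ord.
  rewrite -(card_imset _ (f := fun c => inr (inr c) : forcing_vertex)).
    by apply: subset_leq_card; apply/subsetP => _ /imsetP[c' _ ->]; rewrite inE.
  by move=> c c' [].
- have inj : injective (fun chi => inl [set~ chi] : forcing_vertex).
    by move=> chi chi' [/setC_inj/set1_inj].
  apply: (@leq_trans #|colouring|); last first.
    rewrite -cardsT -(card_imset _ inj); apply: subset_leq_card.
    by apply/subsetP => _ /imsetP[chi _ ->]; rewrite inE /arc /=; apply/existsP; exists chi.
  rewrite card_ffun card_prod !card_ord.
  have M0 : 0 < M.
    by rewrite muln_gt0 /=; apply/card_gt0P; exists [ffun=> (ord0, ord0)].
  rewrite -(prednK M0) expnS -mulnA; apply: leq_pmulr.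
  by rewrite muln_gt0 expn_gt0.
Qed.

Section Forced.
Variable H : subdigraph forcing_digraph.
Hypotheses (H0 : nonempty H) (H2 : min_outdeg_ge 2 H).

Lemma two_out (u : H) : exists v w : H, [/\ arc u v, arc u w & v != w].
Proof.
have /card_gt1P[v [w [uv uw vw]]] := H2 u.
by exists v, w; split=> //; [move: uv | move: uw]; rewrite inE.
Qed.

Lemma arc_val (u v : H) : arc u v -> forcing_arc (val u) (val v).
Proof. by move=> /sub_arcsP[]. Qed.

Lemma reach_colour : exists (u : H) c, val u = inr (inr c).
Proof.
have fromB (u : H) b : val u = inr (inl b) -> exists (u : H) c, val u = inr (inr c).
  move=> uE; have [v [_ [/arc_val uv _ _]]] := two_out u.
  move: uv; rewrite uE.
  by case vE: (val v) => [|[|c]] //= _; exists v, c.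
have /card_gt0P[u _] := H0.
case uE: (val u) => [W|[b|c]]; [|exact: fromB uE|by exists u, c].
have [m] := ubnP #|W|; elim: m => // m IH in u W uE *; rewrite ltnS => Wm.
have [v [_ [/arc_val uv _ _]]] := two_out u.
move: uv; rewrite uE; case vE: (val v) => [W'|[b|c]] //=; last first.
  by move=> _; exact: fromB vE.
move=> /andP[_ /exists_inP[chi chiW /eqP W'E]]; apply: IH vE _.
by apply: leq_trans Wm; rewrite W'E [X in _ < X](cardsD1 chi) chiW.
Qed.

Definition records (chi : colouring) := forall (u : H) b, val u = inr (inl b) ->
  exists v w : H, [/\ arc u v, arc u w, v != w,
    val v = inr (inr (chi b).1) & val w = inr (inr (chi b).2)].

Lemma records_exists : exists chi, records chi.
Proof.
suff /fin_all_exists[chi chiP] b : exists q : pairs, forall u : H,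
    val u = inr (inl b) -> exists v w : H, [/\ arc u v, arc u w, v != w,
    val v = inr (inr q.1) & val w = inr (inr q.2)].
  exists [ffun b => chi b] => u b /chiP[v [w [uv uw vw vE wE]]].
  by exists v, w; rewrite ffunE.
case: (pickP (fun u : H => val u == inr (inl b))) => [u /eqP uE|no]; last first.
  by exists (ord0, ord0) => u uE; have := no u; rewrite uE eqxx.
have [v [w [uv uw vw]]] := two_out u.
move: (arc_val uv) (arc_val uw); rewrite uE.
case vE: (val v) => [|[|x]] //= _; case wE: (val w) => [|[|y]] //= _.
exists (x, y) => u' u'E; have -> : u' = u by apply: val_inj; exact: etrans u'E (esym uE).
by exists v, w.
Qed.

(** Let [chi] record what [H] selects at the vertices ['I_M]. From a vertex of
    ['I_n] one descends through sets of colourings containing [chi]: of two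
    out-neighbours in [H] at least one still contains [chi]. *)
Lemma forced_pattern : exists l b b' c c' : H,
  [/\ arc l b, arc l b' & b != b'] /\
  [/\ c != c', arc b c, arc b c', arc b' c & arc b' c'] /\
  uniq [:: l; b; b'; c; c'].
Proof.
have [chi chiP] := records_exists.
have [r [cr rE]] := reach_colour.
have [u [W [uE chiW]]] : exists (u : H) W, val u = inl W /\ chi \in W.
  have [v [w [rv rw vw]]] := two_out r.
  move: (arc_val rv) (arc_val rw); rewrite rE.
  case vE: (val v) => [Wv|[]] //= /existsP[chiv /eqP WvE].
  case wE: (val w) => [Ww|[]] //= /existsP[chiw /eqP WwE].
  have [chivE|?] := eqVneq chi chiv; last by exists v, Wv; split=> //; rewrite WvE !inE.
  exists w, Ww; split=> //; rewrite WwE !inE; apply: contra vw => /eqP chiwE.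
  by apply/eqP/val_inj; rewrite vE wE WvE WwE -chiwE -chivE.
have [l [L [lE chiL Ln]]] : exists (l : H) L, [/\ val l = inl L, chi \in L & #|L| < n].
  have [m] := ubnP #|W|; elim: m => // m IH in u W uE chiW *; rewrite ltnS => Wm.
  have [Wn|Wn] := ltnP #|W| n; first by exists u, W.
  have [v [w [uv uw vw]]] := two_out u.
  move: (arc_val uv) (arc_val uw); rewrite uE.
  case vE: (val v) => [Wv|[b|]] //=; last by rewrite ltnNge Wn.
  case wE: (val w) => [Ww|[b|]] //=; last by rewrite (ltnNge #|W|) Wn.
  move=> /andP[_ /exists_inP[chiv chivW /eqP WvE]].
  move=> /andP[_ /exists_inP[chiw chiwW /eqP WwE]].
  have card_lt x : x \in W -> #|W :\ x| < m.
    by move=> xW; apply: leq_trans Wm; rewrite [X in _ < X](cardsD1 x) xW.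
  have [chivE|?] := eqVneq chi chiv; last first.
    by apply: IH vE _ _; rewrite WvE ?inE ?chiW ?andbT // card_lt.
  apply: (IH w Ww wE); rewrite WwE ?card_lt // !inE chiW andbT.
  apply: contra vw => /eqP chiwE.
  by apply/eqP/val_inj; rewrite vE wE WvE WwE -chiwE -chivE.
have [b [b' [lb lb' bb']]] := two_out l.
move: (arc_val lb) (arc_val lb'); rewrite lE.
case bE: (val b) => [W1|[x|]] //=.
  by rewrite leqNgt Ln.
case b'E: (val b') => [W1|[x'|]] //=.
  by rewrite (leqNgt n #|L|) Ln.
move=> /andP[_ xL] /andP[_ x'L].
have [_ /forall_inP/(_ chi chiL)/forall_inP/(_ x xL)/forall_inP/(_ x' x'L)/eqP xx'] :=
  constant_setP Ln.
have [c [c' [bc bc' cc' cE c'E]]] := chiP b x bE.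
have [e [e' [b'e b'e' _ eE e'E]]] := chiP b' x' b'E.
have ec : e = c by apply: val_inj; rewrite eE cE xx'.
have ec' : e' = c' by apply: val_inj; rewrite e'E c'E xx'.
exists l, b, b', c, c'; split=> //; split; first by split=> //; rewrite -?ec -?ec'.
rewrite /= !inE !negb_or bb' cc' !andbT /=.
by rewrite -!(inj_eq val_inj) lE bE b'E cE c'E.
Qed.

End Forced.
End Forcing.

Lemma forcing_unavoidable F :
  (forall p (H : subdigraph (forcing_digraph p)),
     nonempty H -> min_outdeg_ge 2 H -> embeds F H) -> ~ avoidable F.
Proof.
move=> embF /(_ 2 isT)[d /(_ (forcing_digraph d))[]].
- by apply/card_gt0P; exists (inr (inr ord0)).
- by move=> u; apply: leq_trans (forcing_outdeg u).
- by move=> H [H0 frH H2]; apply: embeds_not_free frH; apply: embF.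
Qed.

Lemma uniq_quadruples (T : eqType) (l b b' c c' : T) : uniq [:: l; b; b'; c; c'] ->
  uniq [:: l; b; c; b'] /\ uniq [:: b; c; b'; c'].
Proof.
move=> dist; split.
  rewrite (perm_uniq (_ : perm_eq _ [:: l; b; b'; c])).
    by move: dist; rewrite -[_ :: _]/([:: l; b; b'; c] ++ [:: c']) cat_uniq => /andP[].
  by rewrite !perm_cons (perm_catC [:: c] [:: b']).
move: dist => /andP[_]; rewrite !cons_uniq !inE !negb_or (eq_sym c b').
by move=> /and4P[/and3P[-> -> ->] /andP[-> ->] -> _].
Qed.

Lemma C4_22_unavoidable : ~ avoidable C4_22.
Proof.
apply: forcing_unavoidable => p H H0 H2.
have [l [b [b' [c [c' [[lb lb' _] [[_ bc _ b'c _] dist]]]]]]] := forced_pattern H0 H2.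
(* the vertices 0, 1, 2, 3 are sent to [l], [b], [c], [b'] *)
have dist' := (uniq_quadruples dist).1; apply: (@arcs4_embeds _ _ H _ _ _ _ dist') => q.
by rewrite !inE => /or4P[] /eqP ->.
Qed.

Lemma K22_unavoidable : ~ avoidable K22_directed.
Proof.
apply: forcing_unavoidable => p H H0 H2.
have [l [b [b' [c [c' [_ [[_ bc bc' b'c b'c'] dist]]]]]]] := forced_pattern H0 H2.
(* the vertices 0, 1, 2, 3 are sent to [b], [c], [b'], [c'] *)
have dist' := (uniq_quadruples dist).2; apply: (@arcs4_embeds _ _ H _ _ _ _ dist') => q.
by rewrite !inE => /or4P[] /eqP ->.
Qed.

(** * The directed 4-cycle *)

Section NoDirectedC4.
Variables (V : finType) (N : V -> {set V}) (beta k : nat).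
Let g := beta + beta.
Variable part : V -> V -> 'I_g.
Hypotheses (beta0 : 0 < beta) (beta_k : 8 * k ^ 3 <= beta).
Hypothesis N_card : forall v, #|N v| = k * g.

(** [part v] cuts [N v] into [g] parts, and [f v] is the part selected at [v]. *)
Definition chosen_cycle (f : {ffun V -> 'I_g}) v x y z :=
  [&& uniq [:: v; x; y; z],
      (x \in N v) && (part v x == f v), (y \in N x) && (part x y == f x),
      (z \in N y) && (part y z == f y) & (v \in N z) && (part z v == f z)].

Definition acyclic_on (S : {set V}) (f : {ffun V -> 'I_g}) :=
  [forall v in S, forall x in S, forall y in S, forall z in S, ~~ chosen_cycle f v x y z].

Lemma acyclic_onP (S : {set V}) f :
  reflect (forall v x y z, [/\ v \in S, x \in S, y \in S & z \in S] ->
             ~~ chosen_cycle f v x y z)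
          (acyclic_on S f).
Proof.
apply: (iffP idP) => [acyc v x y z [vS xS yS zS]|acyc].
  move: acyc => /forall_inP/(_ v vS)/forall_inP/(_ x xS)/forall_inP/(_ y yS).
  by move=> /forall_inP/(_ z zS).
do 4![apply/forall_inP => ? ?]; exact: acyc.
Qed.

Lemma chosen_cycle_rot f v x y z : chosen_cycle f v x y z = chosen_cycle f x y z v.
Proof.
rewrite /chosen_cycle -(rot_uniq 1 [:: v; x; y; z]); congr (_ && _).
set A := (x \in _) && _; set B := (y \in _) && _.
set C := (z \in _) && _; set D := (v \in _) && _.
by rewrite andbC -!andbA.
Qed.

Lemma acyclic_on_eq (S : {set V}) (f f' : {ffun V -> 'I_g}) :
  {in S, f =1 f'} -> acyclic_on S f -> acyclic_on S f'.
Proof.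
move=> ff' /acyclic_onP acyc; apply/acyclic_onP => v x y z vxyz.
have := acyc v x y z vxyz; rewrite /chosen_cycle; case: vxyz => vS xS yS zS.
by rewrite !ff'.
Qed.

Lemma acyclic_on_sub (S S' : {set V}) f :
  S' \subset S -> acyclic_on S f -> acyclic_on S' f.
Proof.
move=> /subsetP sS /acyclic_onP acyc; apply/acyclic_onP => v x y z [? ? ? ?].
by apply: acyc; split; apply: sS.
Qed.

Let z0 : 'I_g := Ordinal (leq_trans beta0 (leq_addr beta beta)).

(** Partial choices are total functions with a default value outside [S], so that
    they can be counted as a set of finite functions. *)
Definition partial (S : {set V}) := [set f : {ffun V -> 'I_g} |
  [forall u, (u \notin S) ==> (f u == z0)] & acyclic_on S f].

Lemma partial_out (S : {set V}) f u : f \in partial S -> u \notin S -> f u = z0.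
Proof. by rewrite inE => /andP[/forallP/(_ u)/implyP fu _] /fu/eqP. Qed.

Lemma partial_acyclic (S : {set V}) f : f \in partial S -> acyclic_on S f.
Proof. by rewrite inE => /andP[]. Qed.

Definition forget (S : {set V}) (f : {ffun V -> 'I_g}) :=
  [ffun u => if u \in S then f u else z0].

Lemma forget_partial (S S' : {set V}) f :
  S' \subset S -> acyclic_on S f -> forget S' f \in partial S'.
Proof.
move=> sS acyc; rewrite inE; apply/andP; split.
  by apply/forallP => u; apply/implyP => /negPf uS; rewrite ffunE uS.
apply: (@acyclic_on_eq _ f); first by move=> u uS; rewrite ffunE uS.
exact: acyclic_on_sub acyc.
Qed.

Definition extensions (S : {set V}) v := [set f : {ffun V -> 'I_g} |
  [forall u, (u \notin v |: S) ==> (f u == z0)] & acyclic_on S f].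

Lemma card_extensions (S : {set V}) v :
  v \notin S -> g * #|partial S| <= #|extensions S v|.
Proof.
move=> vS; pose upd (p : 'I_g * {ffun V -> 'I_g}) := [ffun u => if u == v then p.1 else p.2 u].
have upd_inj : {in setX [set: 'I_g] (partial S) &, injective upd}.
  move=> [i f] [j f'] /setXP[_ fS] /setXP[_ f'S] /ffunP eq_upd; congr pair.
    by have := eq_upd v; rewrite !ffunE eqxx.
  apply/ffunP => u; have := eq_upd u; rewrite !ffunE; case: eqP => // -> _.
  by rewrite (partial_out fS vS) (partial_out f'S vS).
rewrite -{1}(card_ord g) -cardsT -cardsX -(card_in_imset upd_inj).
apply: subset_leq_card; apply/subsetP => _ /imsetP[[i f] /setXP[_ fS] ->].
rewrite inE; apply/andP; split.
  apply/forallP => u; apply/implyP; rewrite !inE negb_or ffunE => /andP[/negPf-> uS].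
  by rewrite (partial_out fS uS).
apply: acyclic_on_eq (partial_acyclic fS) => u uS; rewrite ffunE.
by case: eqP => // uv; rewrite -uv uS in vS.
Qed.

Definition closing (S : {set V}) v (t : V * V * V) :=
  [set f in extensions S v | chosen_cycle f v t.1.1 t.1.2 t.2].

(** The cycle prescribes the values of [f] at its four vertices. *)
Lemma card_closing (S : {set V}) v x y z : v \notin S -> [/\ x \in S, y \in S & z \in S] ->
  #|closing S v (x, y, z)| <= #|partial (S :\ x :\ y :\ z)|.
Proof.
move=> vS [xS yS zS]; set S' := S :\ x :\ y :\ z.
have forget_inj : {in closing S v (x, y, z) &, injective (forget S')}.
  move=> f f'; rewrite !inE /=.
  move=> /andP[/andP[/forallP f0 _] fc] /andP[/andP[/forallP f'0 _] f'c].
  move=> /ffunP eq_forget; apply/ffunP => u.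
  move: fc f'c => /and5P[_ /andP[_ /eqP fv] /andP[_ /eqP fx] /andP[_ /eqP fy] /andP[_ /eqP fz]].
  move=> /and5P[_ /andP[_ /eqP f'v] /andP[_ /eqP f'x] /andP[_ /eqP f'y] /andP[_ /eqP f'z]].
  have [->|uv] := eqVneq u v; first by rewrite -fv.
  have [->|ux] := eqVneq u x; first by rewrite -fx.
  have [->|uy] := eqVneq u y; first by rewrite -fy.
  have [->|uz] := eqVneq u z; first by rewrite -fz.
  have := eq_forget u; rewrite !ffunE !inE ux uy uz /=.
  have [//|uS _] := boolP (u \in S).
  have := f0 u; have := f'0 u; rewrite !inE (negPf uv) (negPf uS) /=.
  by move=> /eqP-> /eqP->.
rewrite -(card_in_imset forget_inj); apply: subset_leq_card.
apply/subsetP => _ /imsetP[f /setIdP[fE _] ->].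
apply: (@forget_partial S); first by rewrite !subDset !subsetU ?subxx ?orbT.
by move: fE; rewrite inE => /andP[].
Qed.

(** Counting in the style of Rosenfeld. Among the [g * #|partial S|] ways to
    extend a partial choice to [v], those that close a given cycle through [v]
    are determined by the choice away from the cycle. By induction each of the
    three other vertices of the cycle has multiplied the count by [beta], so
    they are at most [#|partial S| / beta ^ 3]. As there are at most [(k * g) ^ 3]
    cycles, and [g = 2 * beta], at least half of the extensions remain. *)
Lemma partial_grow (S : {set V}) v :
  v \notin S -> beta * #|partial S| <= #|partial (v |: S)|.
Proof.
have [m] := ubnP #|S|; elim: m => // m IH in S v *; rewrite ltnS => Sm vS.
pose triples := [set t : V * V * V |
  [&& t.1.1 \in N v, t.1.2 \in N t.1.1, t.2 \in N t.1.2,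
      t.1.1 \in S, t.1.2 \in S, t.2 \in S & uniq [:: t.1.1; t.1.2; t.2]]].
have card_triples : #|triples| <= (k * g) ^ 3.
  have card_dep (A B : finType) (P : {set A}) (Q : A -> {set B}) c :
      (forall a, #|Q a| <= c) ->
      #|[set p : A * B | (p.1 \in P) && (p.2 \in Q p.1)]| <= #|P| * c.
    move=> Qc; rewrite -sum1_card (partition_big fst (mem P)) /=; last first.
      by move=> p; rewrite inE => /andP[].
    rewrite -sum_nat_const; apply: leq_sum => a aP.
    rewrite sum1dep_card; apply: leq_trans (Qc a).
    apply: (@leq_trans #|[set (a, b) | b in Q a]|); last first.
      by rewrite card_imset // => b b' [].
    apply: subset_leq_card; apply/subsetP => -[a' b]; rewrite !inE /=.
    by move=> /andP[/andP[_ bQ] /eqP a'a]; subst a'; apply: imset_f.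
  have Nc v' : #|N v'| <= k * g by rewrite N_card.
  pose P2 := [set p : V * V | (p.1 \in N v) && (p.2 \in N p.1)].
  have c2 : #|P2| <= #|N v| * (k * g) := card_dep V V (N v) N (k * g) Nc.
  have := card_dep _ V P2 (fun p => N p.2) (k * g) (fun p => Nc p.2).
  move=> /leq_trans/(_ (leq_mul c2 (leqnn (k * g)))).
  rewrite N_card !expnS expn0 muln1 -mulnA; apply: leq_trans; apply: subset_leq_card.
  by apply/subsetP => -[[x y] z]; rewrite !inE /= => /and4P[-> -> ->].
have closing_few t : t \in triples -> beta ^ 3 * #|closing S v t| <= #|partial S|.
  case: t => [[x y] z]; rewrite inE /= => /and5P[_ _ _ xS /and5P[yS zS]].
  rewrite !inE negb_or => /andP[xy xz] yz _.
  apply: (@leq_trans (beta ^ 3 * #|partial (S :\ x :\ y :\ z)|)).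
    by rewrite leq_mul2l card_closing ?orbT.
  have shrink (S1 : {set V}) w : #|S1| <= #|S| -> w \in S1 ->
      beta * #|partial (S1 :\ w)| <= #|partial S1|.
    move=> S1S wS1; rewrite -{2}(setD1K wS1); apply: IH; last by rewrite !inE eqxx.
    by apply: leq_trans Sm; apply: leq_trans S1S; rewrite [X in _ < X](cardsD1 w) wS1.
  have sub1 : #|S :\ x| <= #|S| by rewrite subset_leq_card ?subsetDl.
  have sub2 : #|S :\ x :\ y| <= #|S|.
    by apply: leq_trans sub1; rewrite subset_leq_card ?subsetDl.
  rewrite !expnS expn0 muln1 -!mulnA.
  apply: leq_trans (shrink S x (leqnn _) xS); rewrite leq_mul2l; apply/orP; right.
  apply: leq_trans (shrink (S :\ x) y sub1 _); last by rewrite !inE eq_sym xy.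
  rewrite leq_mul2l; apply/orP; right; apply: shrink sub2 _.
  by rewrite !inE (eq_sym z y) yz (eq_sym z x) xz.
have split_ext : extensions S v \subset
    partial (v |: S) :|: \bigcup_(t in triples) closing S v t.
  apply/subsetP => f fE; rewrite in_setU orbC.
  case: (boolP (f \in \bigcup_(t in triples) closing S v t)) => [//|/bigcupP open_v].
  move: (fE); rewrite [f \in extensions _ _]inE => /andP[f0 /acyclic_onP facyc].
  rewrite inE f0 /=; apply/acyclic_onP.
  have from_v x y z : x \in v |: S -> y \in v |: S -> z \in v |: S ->
      ~~ chosen_cycle f v x y z.
    rewrite !inE => xS yS zS; apply/negP => cyc; apply: open_v; exists (x, y, z).
      move: cyc xS yS zS => /and5P[+ /andP[xN _] /andP[yN _] /andP[zN _] _].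
      rewrite [_ \in triples]inE /= xN yN zN !inE !negb_or -!andbA.
      rewrite (eq_sym v x) (eq_sym v y) (eq_sym v z).
      by move=> /and3P[/negPf-> /negPf-> /and4P[/negPf-> -> -> /andP[-> _]]] /= -> -> ->.
    by rewrite inE fE.
  (* a selected cycle passes through [v]; rotate it so that it starts there *)
  move=> a b c d [aS bS cS dS]; apply/negP => cyc.
  have [av|av] := eqVneq a v.
    by move: cyc; apply/negP; rewrite av from_v.
  have [bv|bv] := eqVneq b v.
    by move: cyc; apply/negP; rewrite chosen_cycle_rot bv from_v.
  have [cv|cv] := eqVneq c v.
    by move: cyc; apply/negP; rewrite 2!chosen_cycle_rot cv from_v.
  have [dv|dv] := eqVneq d v.
    by move: cyc; apply/negP; rewrite -chosen_cycle_rot dv from_v.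
  move: aS bS cS dS; rewrite !inE (negPf av) (negPf bv) (negPf cv) (negPf dv) /= => *.
  by move: cyc; apply/negP; apply: facyc.
have ext_le : #|extensions S v| <=
    #|partial (v |: S)| + \sum_(t in triples) #|closing S v t|.
  apply: leq_trans (subset_leq_card split_ext) (leq_trans (leq_card_setU _ _) _).
  by rewrite leq_add2l leq_card_bigcup.
have sum_le : beta ^ 3 * \sum_(t in triples) #|closing S v t| <= (k * g) ^ 3 * #|partial S|.
  rewrite big_distrr /=; apply: (@leq_trans (\sum_(t in triples) #|partial S|)).
    exact: leq_sum.
  by rewrite sum_nat_const leq_mul2r card_triples orbT.
have := leq_trans (card_extensions vS) ext_le.
move: sum_le; set c := \sum_(t in _) _; set F := #|partial S|; set F' := #|partial _|.
have -> : (k * g) ^ 3 = 8 * k ^ 3 * beta ^ 3.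
  by rewrite /g addnn -mul2n !expnMn; lia.
move=> sum_le; have {sum_le} cF : c <= beta * F.
  rewrite -(leq_pmul2l (m := beta ^ 3)) ?expn_gt0 ?beta0 //; apply: leq_trans sum_le _.
  by rewrite [_ * beta ^ 3]mulnC -mulnA leq_mul2l leq_mul2r beta_k !orbT.
by rewrite /g mulnDl; lia.
Qed.

Lemma partial_setT : exists f, acyclic_on [set: V] f.
Proof.
suff: 0 < #|partial [set: V]|.
  by case/card_gt0P=> f /partial_acyclic; exists f.
have [m] := ubnP #|[set: V]|; elim: m ([set: V]) => // m IH S; rewrite ltnS => Sm.
have [->|[v vS]] := set_0Vmem S.
  apply/card_gt0P; exists [ffun=> z0]; rewrite inE; apply/andP; split.
    by apply/forallP => u; rewrite ffunE eqxx implybT.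
  by apply/acyclic_onP => v x y z []; rewrite inE.
rewrite -(setD1K vS); apply: leq_trans (partial_grow _); last by rewrite !inE eqxx.
rewrite muln_gt0 beta0; apply: IH; apply: leq_trans Sm.
by rewrite [X in _ < X](cardsD1 v) vS.
Qed.

End NoDirectedC4.

Lemma no_directed_C4 k : exists d, forall (V : finType) (N : V -> {set V}),
  (forall v, #|N v| = d) -> exists T : V -> {set V},
    [/\ forall v, T v \subset N v, forall v, k <= #|T v| &
      forall v x y z, uniq [:: v; x; y; z] ->
        ~~ [&& x \in T v, y \in T x, z \in T y & v \in T z]].
Proof.
pose beta := (8 * k ^ 3).+1; exists (k * (beta + beta)) => V N N_card.
have [part partP] : exists part : V -> V -> 'I_(beta + beta),
    forall v i, k <= #|[set x in N v | part v x == i]|.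
  apply: (@fin_all_exists _ _ (fun v f => forall i, k <= #|[set x in N v | f x == i]|)).
  by move=> v; apply: chunks; rewrite ?addn_gt0 // N_card mulnC.
have [f /acyclic_onP acyc] := @partial_setT V N beta k part isT (leqnSn _) N_card.
exists (fun v => [set x in N v | part v x == f v]); split=> //.
  by move=> v; apply/subsetP => x; rewrite inE => /andP[].
move=> v x y z vxyz; rewrite !inE.
have := acyc v x y z (And4 (in_setT v) (in_setT x) (in_setT y) (in_setT z)).
by rewrite /chosen_cycle vxyz.
Qed.

(** * Hall's marriage theorem *)

Section Hall.
Variables (L R : finType).

Definition nbrs (r : L -> {set R}) (X : {set L}) := \bigcup_(x in X) r x.

Lemma nbrsD (r : L -> {set R}) (Y : {set R}) X :
  nbrs (fun x => r x :\: Y) X = nbrs r X :\: Y.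
Proof.
apply/setP => y; rewrite inE; apply/bigcupP/andP => [[x xX]|[yY /bigcupP[x xX yx]]].
  by rewrite inE => /andP[yY yx]; split=> //; apply/bigcupP; exists x.
by exists x => //; rewrite inE yY.
Qed.

(** If some set [X] is tight, its neighbours cannot serve anybody else, and both
    [X] and its complement satisfy the condition again; otherwise any edge can be
    used. The matching is optional-valued so as to make sense when [R] is empty. *)
Lemma hall_matching (A : {set L}) (r : L -> {set R}) :
  (forall X : {set L}, X \subset A -> #|X| <= #|nbrs r X|) ->
  exists f : L -> option R,
    {in A, forall x, exists2 y, f x = Some y & y \in r x} /\ {in A &, injective f}.
Proof.
have [m] := ubnP #|A|; elim: m => // m IH in A r *; rewrite ltnS => Am hall.
have [->|[a aA]] := set_0Vmem A.
  by exists (fun=> None); split=> x; rewrite inE.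
(* [f] and [g] match [X] and [A :\: X] into [Y] and its complement *)
have glue (X : {set L}) (Y : {set R}) (f g : L -> option R) :
    {in X, forall x, exists2 y, f x = Some y & y \in r x :&: Y} ->
    {in A :\: X, forall x, exists2 y, g x = Some y & y \in r x :\: Y} ->
    {in X &, injective f} -> {in A :\: X &, injective g} ->
  exists f : L -> option R,
    {in A, forall x, exists2 y, f x = Some y & y \in r x} /\ {in A &, injective f}.
  move=> fP gP f_inj g_inj; exists (fun x => if x \in X then f x else g x); split.
    move=> x xA; case: ifPn => xX.
      by have [y -> /setIP[yx _]] := fP x xX; exists y.
    by have [|y -> /setDP[yx _]] := gP x; rewrite ?inE ?xX //; exists y.
  have inD z : z \in A -> z \notin X -> z \in A :\: X by move=> zA zX; rewrite inE zX.
  move=> x x' xA x'A; case: ifPn => xX; case: ifPn => x'X.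
  + exact: f_inj.
  + have [y -> /setIP[_ yY]] := fP x xX.
    have [y' -> /setDP[_ /negP y'Y] [yy']] := gP x' (inD x' x'A x'X).
    by rewrite yy' in yY.
  + have [y' -> /setIP[_ y'Y]] := fP x' x'X.
    have [y -> /setDP[_ /negP yY] [yy']] := gP x (inD x xA xX).
    by rewrite -yy' in y'Y.
  + by apply: g_inj; apply: inD.
pose tight (X : {set L}) := [&& X \proper A, X != set0 & #|nbrs r X| <= #|X|].
have [/existsP[X /and3P[XA X0 XN]]|/existsPn slack] := boolP [exists X, tight X].
- have sXA := proper_sub XA.
  have [||f [fP f_inj]] := IH X r.
  + exact: leq_trans (proper_card XA) Am.
  + by move=> Y YX; apply: hall; apply: subset_trans sXA.
  have [||g [gP g_inj]] := IH (A :\: X) (fun x => r x :\: nbrs r X).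
  + apply: leq_trans Am; rewrite cardsD (setIidPr sXA) ltn_subrL card_gt0 X0.
    by rewrite card_gt0; apply/set0Pn; exists a.
  + move=> Y; rewrite subsetD => /andP[YA YX]; rewrite nbrsD.
    have := hall (Y :|: X); rewrite subUset YA sXA => /(_ isT).
    have -> : nbrs r (Y :|: X) = (nbrs r Y :\: nbrs r X) :|: nbrs r X.
      rewrite /nbrs bigcup_setU; apply/setP => y; rewrite !inE.
      by case: (y \in \bigcup_(x in X) r x); rewrite ?orbT ?orbF.
    rewrite !cardsU (disjoint_setI0 YX) cards0 subn0.
    set D := nbrs r Y :\: nbrs r X.
    by have := leq_subr #|D :&: nbrs r X| (#|D| + #|nbrs r X|); lia.
  apply: (glue X (nbrs r X) f g _ gP f_inj g_inj) => x xX.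
  by have [y fx yx] := fP x xX; exists y => //; rewrite inE yx; apply/bigcupP; exists x.
- have [ra0|[y ya]] := set_0Vmem (r a).
    have := hall [set a]; rewrite sub1set aA cards1 /nbrs big_set1 ra0 cards0.
    by move=> /(_ isT).
  have [||g [gP g_inj]] := IH (A :\ a) (fun x => r x :\ y).
  + by apply: leq_trans Am; rewrite [X in _ < X](cardsD1 a) aA.
  + move=> X XA; rewrite nbrsD; have [->|X0] := eqVneq X set0; first by rewrite cards0.
    have := slack X; rewrite /tight X0 (sub_proper_trans XA) ?properD1 //= -ltnNge.
    by rewrite [#|nbrs r X|](cardsD1 y); case: (y \in _) => /=; lia.
  apply: (glue [set a] [set y] (fun=> Some y) g) => //.
  + by move=> x /set1P->; exists y => //; rewrite !inE ya eqxx.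
  + by move=> x x' /set1P-> /set1P->.
Qed.

End Hall.

(** Every [b] in [A] selects [k] elements of [M b] so that no element is selected
    more than [s] times. To this end [M b] is cut into [k] parts, and the pairs
    of [b] and one of its parts are matched with the [s] copies of elements of
    that part: such a pair has at least [e * s] candidates and a copy at most
    [e * s] suitors, since [b] has only one part that contains a given element. *)
Lemma bounded_load (V : finType) (A : {set V}) (M : V -> {set V}) k e s :
  0 < e -> 0 < s -> 0 < k -> (forall b, b \in A -> k * e <= #|M b|) ->
  (forall c, #|[set b in A | c \in M b]| <= e * s) ->
  exists T : V -> {set V}, [/\ forall b, T b \subset M b,
    forall b, b \in A -> k <= #|T b|, forall b, #|T b| <= k &
    forall c, #|[set b in A | c \in T b]| <= s].
Proof.
move=> e0 s0 k0 Mbig indeg.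
have [part partP] : exists part : V -> V -> 'I_k, forall b, b \in A ->
    forall i, e <= #|[set c in M b | part b c == i]|.
  apply: (@fin_all_exists _ _ (fun b f => b \in A ->
    forall i, e <= #|[set c in M b | f c == i]|)) => b.
  have [bA|] := boolP (b \in A); last by exists (fun=> Ordinal k0).
  by have [f fP] := chunks k0 (Mbig b bA); exists f.
pose r (x : V * 'I_k) : {set V * 'I_s} :=
  [set y | (y.1 \in M x.1) && (part x.1 y.1 == x.2)].
have [|f [fP f_inj]] := @hall_matching _ _ (setX A setT) r.
  move=> X XA; rewrite -(leq_pmul2r (m := e * s)) ?muln_gt0 ?e0 //.
  apply: (@leq_trans (\sum_(x in X) \sum_(y in nbrs r X | y \in r x) 1)).
    rewrite -sum_nat_const; apply: leq_sum => x xX; rewrite sum1dep_card.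
    have /setXP[bA _] : (x.1, x.2) \in setX A setT.
      by rewrite -surjective_pairing (subsetP XA).
    apply: leq_trans (_ : #|setX [set c in M x.1 | part x.1 c == x.2] [set: 'I_s]| <= _).
      by rewrite cardsX cardsT card_ord leq_mul2r partP ?orbT.
    apply: subset_leq_card; apply/subsetP => y; rewrite !inE andbT => yx.
    by rewrite yx andbT; apply/bigcupP; exists x => //; rewrite inE.
  rewrite (exchange_big_dep (fun y => y \in nbrs r X)) => [|? ? _ /andP[]] //=.
  rewrite -sum_nat_const; apply: leq_sum => y yN.
  rewrite (eq_bigl (fun x => (x \in X) && (y \in r x))) => [|x]; last by rewrite yN.
  rewrite sum1dep_card; apply: leq_trans (indeg y.1).
  have inj : {in [set x in X | y \in r x] &, injective fst}.
    move=> [b i] [b' i']; rewrite !inE /= => /and3P[_ _ /eqP <-] /and3P[_ _ /eqP <-].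
    by move=> ->.
  rewrite -(card_in_imset inj); apply: subset_leq_card; apply/subsetP => _ /imsetP[x + ->].
  rewrite !inE => /and3P[xX -> _]; rewrite andbT.
  have : (x.1, x.2) \in setX A setT by rewrite -surjective_pairing (subsetP XA).
  by case/setXP.
have fE b i : b \in A -> exists c j, [/\ f (b, i) = Some (c, j), c \in M b & part b c = i].
  move=> bA; have [|[c j] fbi] := fP (b, i); first by rewrite !inE bA.
  by rewrite inE => /andP[cM /eqP bc]; exists c, j.
pose T b := if b \in A then [set c | [exists i, exists j, f (b, i) == Some (c, j)]] else set0.
have TP b c : c \in T b -> b \in A /\ exists i j, f (b, i) = Some (c, j).
  rewrite /T; case: ifP => // bA; rewrite !inE // => /existsP[i /existsP[j /eqP fbi]].
  by split=> //; exists i, j.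
have partE b i c j : b \in A -> f (b, i) = Some (c, j) -> c \in M b /\ part b c = i.
  by move=> bA fbi; have [c' [j' []]] := fE b i bA; rewrite fbi => -[<- _].
have [mate mateP] : exists mate : V -> 'I_k -> V, forall b, b \in A ->
    forall i, exists j, f (b, i) = Some (mate b i, j).
  apply: (@fin_all_exists _ _ (fun b m => b \in A ->
    forall i, exists j, f (b, i) = Some (m i, j))) => b.
  have [bA|] := boolP (b \in A); last by exists (fun=> b).
  have [m mP] := fin_all_exists (fun i => fE b i bA).
  by exists m => _ i; have [j []] := mP i; exists j.
have T_mate b : b \in A -> T b = [set mate b i | i : 'I_k].
  move=> bA; apply/setP => c; apply/idP/imsetP => [/TP[_ [i [j fbi]]]|[i _ ->]].
    by exists i => //; have [j'] := mateP b bA i; rewrite fbi => -[].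
  rewrite /T bA inE; apply/existsP; exists i; apply/existsP.
  by have [j fbi] := mateP b bA i; exists j; apply/eqP.
exists T; split=> [b|b bA|b|c].
- by apply/subsetP => c /TP[bA [i [j fbi]]]; have [] := partE b i c j bA fbi.
- rewrite T_mate // card_imset ?card_ord // => i i' eq_mate.
  have [j /(partE _ _ _ _ bA)[_ <-]] := mateP b bA i.
  by have [j' /(partE _ _ _ _ bA)[_ <-]] := mateP b bA i'; rewrite eq_mate.
- have [bA|bA] := boolP (b \in A); last by rewrite /T (negPf bA) cards0.
  by rewrite T_mate //; apply: leq_trans (leq_imset_card _ _) _; rewrite card_ord.
- have [slot slotP] : exists slot : V -> 'I_s, forall b, c \in T b ->
      exists i, f (b, i) = Some (c, slot b).
    apply: (@fin_all_exists _ _ (fun b j => c \in T b -> exists i, f (b, i) = Some (c, j))) => b.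
    have [cb|] := boolP (c \in T b); last by exists (Ordinal s0).
    by have [_ [i [j fbi]]] := TP b c cb; exists j => _; exists i.
  rewrite -[leqRHS]card_ord; apply: (@leq_card_in _ _ slot) => b b'.
  rewrite !inE => /andP[bA cb] /andP[b'A cb'] eq_slot.
  have [[i fbi] [i' fb'i']] := (slotP b cb, slotP b' cb').
  suff [] : (b, i) = (b', i') by [].
  by apply: f_inj; rewrite ?inE ?bA ?b'A // fbi fb'i' eq_slot.
Qed.

(** * Orders and colourings *)

Lemma low_indegree (V : finType) (r : rel V) (U : {set V}) q : U != set0 ->
  (forall u, u \in U -> #|[set v in U | r u v]| <= q) ->
  exists2 v, v \in U & #|[set u in U | r u v]| <= q.
Proof.
move=> U0 out; apply/exists_inP; apply: contraT => /exists_inPn big_in.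
have : \sum_(v in U) \sum_(u in U | r u v) 1 <= #|U| * q.
  apply: (@leq_trans (\sum_(u in U) q)); last by rewrite sum_nat_const.
  rewrite (exchange_big_dep (fun u => u \in U)) => [|? ? _ /andP[]] //=.
  apply: leq_sum => u uU.
  rewrite (eq_bigl (fun v => (v \in U) && r u v)) => [|v]; last by rewrite uU.
  by rewrite sum1dep_card out.
have /card_gt0P[v0 v0U] : 0 < #|U| by rewrite card_gt0.
have <- : \sum_(u in U) q = #|U| * q by rewrite sum_nat_const.
rewrite leqNgt => /negP[].
rewrite (bigD1 v0) //= [ltnRHS](bigD1 v0) //= -addSn.
have lt v : v \in U -> q < \sum_(u in U | r u v) 1.
  by move=> vU; rewrite sum1dep_card ltnNge big_in.
apply: leq_add; first exact: lt.
by apply: leq_sum => v /andP[vU _]; apply: ltnW; apply: lt.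
Qed.

(** The order is built from its end: the average in-degree inside any set is at
    most [d], so a vertex of in-degree at most [d] can be placed last. *)
Lemma degenerate_order (V : finType) (N : V -> {set V}) d : (forall v, #|N v| <= d) ->
  exists pos : V -> nat, [/\ injective pos, forall v, pos v < #|V| &
    forall v, #|[set u | (v \in N u) && (pos u < pos v)]| <= d].
Proof.
move=> Nd; suff [pos [pos_inj pos_lt indeg]] : exists pos : V -> nat,
    [/\ {in [set: V] &, injective pos}, forall v, v \in [set: V] -> pos v < #|[set: V]| &
    forall v, v \in [set: V] -> #|[set u in [set: V] | (v \in N u) && (pos u < pos v)]| <= d].
  exists pos; split=> [u v|v|v]; first by apply: pos_inj; rewrite in_setT.
    by rewrite -cardsT pos_lt.
  apply: leq_trans (indeg v (in_setT v)); apply: subset_leq_card.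
  by apply/subsetP => u; rewrite !inE.
have [m] := ubnP #|[set: V]|; elim: m ([set: V]) => // m IH U; rewrite ltnS => Um.
have [->|U0] := eqVneq U set0.
  by exists (fun=> 0); split=> [u|u|u]; rewrite inE.
have [|v vU vd] := @low_indegree V (fun u v => v \in N u) U d U0.
  move=> u _; apply: leq_trans (Nd u); apply: subset_leq_card.
  by apply/subsetP => w; rewrite inE => /andP[].
have Uv : #|U| = #|U :\ v|.+1 by rewrite [LHS](cardsD1 v) vU.
have [|pos [pos_inj pos_lt indeg]] := IH (U :\ v); first by rewrite -Uv.
pose pos' u := if u == v then #|U :\ v| else pos u.
have pos'_lt u : u \in U -> u != v -> pos' u < #|U :\ v|.
  by move=> uU uv; rewrite /pos' (negPf uv) pos_lt // !inE uv.
exists pos'; split.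
- move=> x y xU yU; have [->|xv] := eqVneq x v; have [->|yv] := eqVneq y v => // eq_pos.
  + by have := pos'_lt y yU yv; rewrite -eq_pos {1}/pos' eqxx ltnn.
  + by have := pos'_lt x xU xv; rewrite eq_pos {1}/pos' eqxx ltnn.
  + move: eq_pos; rewrite /pos' (negPf xv) (negPf yv).
    by apply: pos_inj; rewrite !inE ?xv ?yv.
- move=> u uU; have [->|uv] := eqVneq u v; first by rewrite /pos' eqxx Uv.
  by rewrite Uv ltnS ltnW ?pos'_lt.
- move=> w wU; have [->|wv] := eqVneq w v.
    apply: leq_trans vd; apply: subset_leq_card; apply/subsetP => u.
    by rewrite !inE => /and3P[-> ->].
  have := indeg w; rewrite !inE wv wU => /(_ isT); apply: leq_trans.
  apply: subset_leq_card; apply/subsetP => u; rewrite !inE => /and3P[uU wu].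
  have [->|uv] := eqVneq u v.
    by rewrite /pos' eqxx (negPf wv) ltnNge ltnW // pos_lt // !inE wv.
  by rewrite /pos' (negPf uv) (negPf wv) uU wu.
Qed.

(** A vertex of low in-degree has at most [2 * q] neighbours, whatever the
    direction; take it, drop its neighbours, and continue. *)
Lemma independent_subset (V : finType) (r : rel V) q k (A : {set V}) :
  (forall a, #|[set b in A | r a b]| <= q) -> k * (q + q).+1 <= #|A| ->
  exists B : {set V}, [/\ B \subset A, k <= #|B| &
    forall a b, a \in B -> b \in B -> a != b -> ~~ r a b].
Proof.
elim: k => [|k IH] in A *; first by exists set0; split=> [||a b]; rewrite ?sub0set ?inE.
move=> out Ak.
have A0 : A != set0 by rewrite -card_gt0; apply: leq_trans Ak; rewrite muln_gt0.
have [v vA v_in] := low_indegree A0 (fun u _ => out u).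
pose near := v |: ([set b in A | r v b] :|: [set a in A | r a v]).
have near_card : #|near| <= (q + q).+1.
  apply: leq_trans (leq_card_setU _ _) _; rewrite cards1 add1n ltnS.
  by apply: leq_trans (leq_card_setU _ _) _; apply: leq_add.
have [||B [BA kB Bind]] := IH (A :\: near).
- move=> a; apply: leq_trans (out a); apply: subset_leq_card.
  by apply/subsetP => b; rewrite !inE => /andP[/andP[_ ->]].
- have := cardsID near A; have := subset_leq_card (subsetIr A near); lia.
have B_far b : b \in B -> [/\ b != v, ~~ r v b & ~~ r b v].
  move=> /(subsetP BA); rewrite !inE !negb_or => /andP[/and3P[bv + +] bA].
  by rewrite bA.
exists (v |: B); split.
- by rewrite subUset sub1set vA; apply: subset_trans BA (subsetDl _ _).
- rewrite cardsU1 (_ : v \notin B) //; apply/negP => /B_far[].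
  by rewrite eqxx.
- move=> a b /setU1P[->|aB] /setU1P[->|bB]; first by rewrite eqxx.
  + by have [] := B_far b bB.
  + by have [] := B_far a aB.
  + exact: Bind.
Qed.

(** The values are chosen by increasing rank; since [P v] looks at smaller ranks
    only, later choices do not disturb earlier ones. *)
Lemma rank_choice (V : finType) (C : Type) (c0 : C) (rk : V -> nat)
    (P : V -> (V -> C) -> C -> Prop) :
  (forall v f g c, (forall u, rk u < rk v -> f u = g u) -> P v f c -> P v g c) ->
  (forall v f, exists c, P v f c) -> exists f, forall v, P v f (f v).
Proof.
move=> Ploc Pex; suff [f fP] : exists f, forall v, rk v < (\max_v rk v).+1 -> P v f (f v).
  by exists f => v; apply: fP; rewrite ltnS leq_bigmax.
elim: (\max_v rk v).+1 => [|m [f fP]]; first by exists (fun=> c0).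
have [h hP] := fin_all_exists (fun v => Pex v f).
exists (fun v => if rk v == m then h v else f v) => v; rewrite ltnS leq_eqVlt.
have same u : rk u < m -> (if rk u == m then h u else f u) = f u by case: ltngtP.
case: eqP => [rkv _|_ /= rkv].
- by apply: Ploc (hP v) => u; rewrite rkv => /same.
- by apply: Ploc (fP v rkv) => u /ltn_trans/(_ rkv)/same.
Qed.

(** Colours and targets are chosen from the sinks upwards: if [(y, z)] is the most
    popular pair of a colour and a target among the out-neighbours of [v], then
    [v] takes the target [y] and a colour different from [z]. Once the vertices
    of [A] keep only the arcs counted here, their out-neighbourhoods are
    monochromatic, and a vertex of [A] differs in colour from the vertices that
    are reached from it in two steps through [A]. *)
Lemma acyclic_colouring (V : finType) (rk : V -> nat) (A : pred V) (N : V -> {set V}) :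
  (forall v u, A v -> u \in N v -> rk u < rk v) ->
  exists colour target : V -> bool, forall v, A v -> #|N v| <=
    4 * #|[set c in N v | (colour c == target v) && (target c != colour v)]|.
Proof.
move=> N_rk; pose P v (f : V -> bool * bool) (c : bool * bool) := A v -> #|N v| <=
  4 * #|[set u in N v | ((f u).1 == c.2) && ((f u).2 != c.1)]|.
have [v f g c fg|v f|f fP] := @rank_choice V _ (true, true) rk P.
- rewrite /P => Pf Av; apply: leq_trans (Pf Av) _; rewrite leq_mul2l /=.
  apply: subset_leq_card; apply/subsetP => u; rewrite !inE => /andP[uN].
  by rewrite uN fg ?N_rk.
- have [|[y z] yz] := popular f (N v); first by rewrite card_prod card_bool.
  exists (~~ z, y) => _; apply: leq_trans yz _; rewrite card_prod card_bool leq_mul2l /=.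
  apply: subset_leq_card; apply/subsetP => u; rewrite !inE => /andP[-> /eqP->] /=.
  by rewrite eqxx; case: z.
- by exists (fun v => (f v).1), (fun v => (f v).2) => v; apply: fP.
Qed.

Lemma acyclic_majority (V : finType) (rk : V -> nat) (w : V -> V -> nat) l : 0 < l ->
  exists f : V -> 'I_l, forall v,
    l * \sum_(u | (rk u < rk v) && (f u == f v)) w v u <= \sum_(u | rk u < rk v) w v u.
Proof.
move=> l0; have cl : 0 < #|'I_l| by rewrite card_ord.
apply: (@rank_choice V _ (Ordinal l0) rk (fun v f c =>
  l * \sum_(u | (rk u < rk v) && (f u == c)) w v u <= \sum_(u | rk u < rk v) w v u)).
- move=> v f g c fg; congr (l * _ <= _); apply: eq_bigl => u.
  by case: ltnP => //= /fg->.
- move=> v f; have [c] := light_class f (fun u => rk u < rk v) (w v) cl.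
  by rewrite card_ord; exists c.
Qed.

(** A digraph is the union of two acyclic digraphs, the arcs that go up and the
    arcs that go down in an arbitrary order, and each of them is taken care of by
    one coordinate of the colour. *)
Lemma majority_colouring (V : finType) (w : V -> V -> nat) l : 0 < l ->
  exists f : V -> 'I_l * 'I_l, forall v,
    l * \sum_(u | (u != v) && (f u == f v)) w v u <= \sum_u w v u.
Proof.
move=> l0; pose up (v : V) : nat := enum_rank v; pose down (v : V) := #|V| - up v.
have [f fP] := acyclic_majority up w l0; have [g gP] := acyclic_majority down w l0.
have downE u v : (down u < down v) = (up v < up u).
  have : up u < #|V| := ltn_ord _; have : up v < #|V| := ltn_ord _.
  rewrite /down; lia.
have upE u v : (up u != up v) = (u != v) by rewrite (inj_eq val_inj) (inj_eq enum_rank_inj).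
exists (fun v => (f v, g v)) => v.
have split_sum (Q : pred V) : \sum_(u | (u != v) && Q u) w v u =
    \sum_(u | (up u < up v) && Q u) w v u + \sum_(u | (down u < down v) && Q u) w v u.
  rewrite (bigID (fun u => up u < up v)) /=; congr addn; apply: eq_bigl => u.
    rewrite -upE; case: (ltngtP (up u) (up v)) => //=; by rewrite andbC.
  by rewrite -upE downE; case: (ltngtP (up u) (up v)); rewrite /= ?andbF ?andbT.
have sub (Q Q' : pred V) : (forall u, Q u -> Q' u) ->
    \sum_(u | Q u) w v u <= \sum_(u | Q' u) w v u.
  move=> QQ'; rewrite big_mkcond [leqRHS]big_mkcond leq_sum // => u _.
  by case: ifP => // /QQ'->.
rewrite split_sum mulnDr; apply: (@leq_trans (\sum_(u | (u != v) && true) w v u)).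
  2: exact: sub.
rewrite split_sum; apply: leq_add.
- apply: leq_trans (leq_trans (fP v) _); last by apply: sub => u ->.
  rewrite leq_mul2l; apply/orP; right; apply: sub => u /andP[->] /=.
  by rewrite xpair_eqE => /andP[].
- apply: leq_trans (leq_trans (gP v) _); last by apply: sub => u ->.
  rewrite leq_mul2l; apply/orP; right; apply: sub => u /andP[->] /=.
  by rewrite xpair_eqE => /andP[].
Qed.

(** * The transitive orientation *)

Section Transitive.
Variables (k : nat) (k0 : 0 < k).

(* [s] bounds the number of ascending arcs selected into a vertex; [m] is the
   number of colours of the majority colouring, and [l] is large enough for the
   colours of [s] vertices to be rare together; [e'] leaves room, after passing to
   one of [m] colours, for [s * k * s] vertices to be avoided and for an
   independent set of size [k]. *)
Let s := 32 * k.
Let l := 4 * s.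
Let m := l * l.
Let e' := 4 * m * (k + s * k * s + k * (k * k + k * k).+1).
Let e := 2 * (k * e').

Variables (V : finType) (N : V -> {set V}).
Hypotheses (N_irr : forall v, v \notin N v) (N_card : forall v, #|N v| = 16 * e).

(** In terms of an order with few earlier in-neighbours, [fwd v] means that the
    arcs kept at [v] ascend, and [to_fwd v] that they lead to vertices in [fwd].
    The arcs kept at the vertices with [fwd v = to_fwd v] form two acyclic
    digraphs, one ascending and one descending, on disjoint sets of vertices; so
    [acyclic_colouring] applies. Its targets are [goal]; the other vertices just
    keep the arcs to the more popular hue. *)
Lemma oriented_selection :
  exists (fwd to_fwd : V -> bool) (N1 : V -> {set V}) (hue goal : V -> bool),
  [/\ forall v, N1 v \subset N v /\ #|N1 v| = e,
      forall v u, u \in N1 v -> fwd u = to_fwd v,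
      forall c, #|[set b | fwd b && (c \in N1 b)]| <= 16 * e,
      forall v u, u \in N1 v -> hue u = goal v &
      forall v u, fwd v = to_fwd v -> fwd u = to_fwd u -> u \in N1 v -> goal u != hue v].
Proof.
have [|pos [pos_inj pos_lt indeg]] := @degenerate_order V N (16 * e).
  by move=> v; rewrite N_card.
have half (f : V -> bool) (A : {set V}) : exists x, #|A| <= 2 * #|[set u in A | f u == x]|.
  by have [|x] := popular f A; rewrite card_bool //; exists x.
have [fwd fwdP] := fin_all_exists (fun v => half (fun u => pos v < pos u) (N v)).
pose Nf v := [set u in N v | (pos v < pos u) == fwd v].
have [to_fwd to_fwdP] := fin_all_exists (fun v => half fwd (Nf v)).
pose Nt v := [set u in Nf v | fwd u == to_fwd v].
have Nt_card v : 4 * e <= #|Nt v|.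
  have := fwdP v; have := to_fwdP v; rewrite N_card -/(Nt v) -/(Nf v); lia.
pose rk v := if fwd v then #|V| - pos v else pos v.
pose same v := fwd v == to_fwd v.
have [v u|hue [aim aimP]] := @acyclic_colouring V rk same Nt.
  rewrite !inE /same => /eqP vv /andP[/andP[uN /eqP vu] /eqP uv].
  have neq : pos u != pos v.
    by rewrite (inj_eq pos_inj); apply: contraTneq uN => ->; apply: N_irr.
  rewrite /rk uv -vv; move: vu; have := pos_lt v; have := pos_lt u.
  by case: (fwd v); lia.
have [pop popP] := fin_all_exists (fun v => half hue (Nt v)).
pose goal v := if same v then aim v else pop v.
pose No v := [set u in Nt v | (hue u == goal v) && (same v ==> (aim u != hue v))].
have No_card v : e <= #|No v|.
  have := Nt_card v; have [vs|vs] := boolP (same v).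
    have -> : No v = [set u in Nt v | (hue u == aim v) && (aim u != hue v)].
      by apply/setP => u; rewrite !inE /goal vs.
    by have := aimP v vs; lia.
  have -> : No v = [set u in Nt v | hue u == pop v].
    by apply/setP => u; rewrite !inE /goal (negPf vs) andbT.
  by have := popP v; lia.
have [N1 N1P N1_card] := fin_all_exists2 (fun v => subset_of_card (No_card v)).
have N1E v u : u \in N1 v -> [/\ u \in N v, (pos v < pos u) = fwd v, fwd u = to_fwd v,
    hue u = goal v & same v -> aim u != hue v].
  move=> /(subsetP (N1P v)); rewrite !inE.
  by move=> /and3P[/andP[/andP[uN /eqP vu] /eqP uv] /eqP hu /implyP].
exists fwd, to_fwd, N1, hue, goal; split=> [v|v u|c|v u|v u vs us].
- by split=> //; apply/subsetP => u /N1E[].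
- by case/N1E.
- apply: leq_trans (indeg c); apply: subset_leq_card; apply/subsetP => b.
  by rewrite !inE => /andP[bf /N1E[-> ->]].
- by case/N1E.
- by case/N1E => _ _ _ _; rewrite /goal /same vs us !eqxx; apply.
Qed.

Let l0 : 0 < l. Proof. by rewrite /l /s !muln_gt0 k0. Qed.

Section Mixed.
Variables (fwd to_fwd : V -> bool) (N1 : V -> {set V}).
Hypotheses (N1_card : forall v, #|N1 v| = e)
  (N1_indeg : forall c, #|[set b | fwd b && (c \in N1 b)]| <= 16 * e).

Definition up_down v := fwd v && ~~ to_fwd v.
Definition down_up v := ~~ fwd v && to_fwd v.

Let e'0 : 0 < e'. Proof. by rewrite /e' /m; have := l0; have := k0; nia. Qed.
Let e_big : 4 * s <= e.
Proof.
have s0 : 0 < s by rewrite /s; lia.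
have le1 : 4 * s <= m by rewrite /m /l; nia.
have le2 : m <= e' by rewrite /e'; have := k0; nia.
by rewrite /e; have := k0; nia.
Qed.

(** For [b] in [up_down] and [c] in [N1 b] the clashes are the elements of [N1 c] of
    the same shade as [b]. By the majority property at least half of the [c] have
    at most [e / (2 * s)] clashes with [b]; from these [b] selects [U b], each [c]
    being selected at most [s] times. Then [c] can drop its clashes with all the
    vertices that selected it, and keeps about half of [N1 c]. *)
Lemma up_down_selection : exists (shade : V -> 'I_l * 'I_l) (U N2 : V -> {set V}),
  [/\ forall b, U b \subset N1 b, forall b, up_down b -> k <= #|U b| <= k,
      forall c, #|[set b | up_down b && (c \in U b)]| <= s,
      forall c, N2 c \subset N1 c /\ e <= 4 * #|N2 c| &
      forall b c d, up_down b -> c \in U b -> down_up c -> d \in N2 c -> shade d != shade b].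
Proof.
pose w b d := \sum_(c in N1 b | down_up c && (d \in N1 c)) 1.
have [shade shadeP] := majority_colouring w l0.
pose clash b c := [set d in N1 c | (d != b) && (shade d == shade b)].
have w_sum b : \sum_d w b d <= e * e.
  apply: (@leq_trans (\sum_(c in N1 b) e)); last by rewrite sum_nat_const N1_card.
  rewrite (exchange_big_dep (fun c => c \in N1 b)) /= => [|? ? _ /andP[]] //.
  apply: leq_sum => c cN; rewrite -(N1_card c) -[leqRHS]sum1_card.
  rewrite big_mkcond [leqRHS]big_mkcond; apply: leq_sum => d _.
  by rewrite cN /=; case: (down_up c) => //=; case: ifP.
have clash_sum b : \sum_(c in N1 b | down_up c) #|clash b c| <=
    \sum_(d | (d != b) && (shade d == shade b)) w b d.
  rewrite /w (exchange_big_dep (fun c => (c \in N1 b) && down_up c)) /=; last first.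
    by move=> d c _ /and3P[-> ->].
  apply: leq_sum => c /andP[cN cdu]; rewrite -sum1_card.
  rewrite big_mkcond [leqRHS]big_mkcond; apply: leq_sum => d _.
  by rewrite !inE cN cdu /= andbC; case: (_ && _).
pose M b := [set c in N1 b | down_up c ==> (2 * s * #|clash b c| < e)].
have M_card b : k * e' <= #|M b|.
  pose bad := [set c in N1 b | ~~ (down_up c ==> (2 * s * #|clash b c| < e))].
  have bad_sum : e * #|bad| <= 2 * s * \sum_(c in N1 b | down_up c) #|clash b c|.
    rewrite big_distrr /= mulnC -sum_nat_const.
    rewrite big_mkcond [leqRHS]big_mkcond; apply: leq_sum => c _; rewrite !inE.
    by case: (c \in N1 b) => //=; case: (down_up c); rewrite //= -leqNgt; case: ifP.
  have := leq_trans (shadeP b) (w_sum b); have := clash_sum b.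
  have := cardsID (M b) (N1 b).
  rewrite (setIidPr _); last by apply/subsetP => c; rewrite inE => /andP[].
  rewrite (_ : N1 b :\: M b = bad).
    move: bad_sum; rewrite N1_card /l; set B := #|bad|.
    set C := \sum_(c in N1 b | _) _; set W := \sum_(d | _) _ => eB MB CW We.
    have : 2 * B <= e.
      have [e0|e0] := posnP e; first by lia.
      rewrite -(leq_pmul2l e0).
      have : 2 * s * C <= 2 * s * W by rewrite leq_mul2l CW orbT.
      by lia.
    by rewrite /e; lia.
  by apply/setP => c; rewrite !inE; case: (c \in N1 b); rewrite ?andbT ?andbF.
have s0 : 0 < s by rewrite /s; lia.
have [||U [UM kU Uk load]] := @bounded_load V [set b | up_down b] M k e' s e'0 s0 k0.
- by move=> b _.
- move=> c; apply: leq_trans (_ : 16 * e <= _); last by rewrite /e /s; lia.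
  apply: leq_trans (N1_indeg c); apply: subset_leq_card; apply/subsetP => b.
  by rewrite !inE => /andP[/andP[-> _] /andP[-> _]].
have {}load c : #|[set b | up_down b && (c \in U b)]| <= s.
  by apply: leq_trans (load c); apply: subset_leq_card; apply/subsetP => b; rewrite !inE.
pose In c := [set b | up_down b && (c \in U b)].
pose N2 c := [set d in N1 c | down_up c ==> [forall b in In c, shade d != shade b]].
exists shade, U, N2; split.
- by move=> b; apply: subset_trans (UM b) _; apply/subsetP => c; rewrite inE => /andP[].
- by move=> b bud; rewrite kU ?inE // Uk.
- exact: load.
- move=> c; split; first by apply/subsetP => d; rewrite inE => /andP[].
  have [cdu|cdu] := boolP (down_up c); last first.
    rewrite (_ : N2 c = N1 c) ?N1_card; first by lia.
    by apply/setP => d; rewrite inE (negPf cdu) andbT.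
  (* [b] itself may occur in [N1 c]; as it has its own shade it is dropped too *)
  have sub : N1 c :\: N2 c \subset \bigcup_(b in In c) (b |: clash b c).
    apply/subsetP => d; rewrite !inE cdu /= andbC => /andP[dN]; rewrite dN /=.
    move=> /forall_inPn[b bIn]; rewrite negbK => sh.
    apply/bigcupP; exists b => //; rewrite !inE dN sh andbT.
    by case: eqP.
  have card_union : 2 * s * #|\bigcup_(b in In c) (b |: clash b c)| <= s * (2 * s + e).
    apply: (@leq_trans (\sum_(b in In c) (2 * s + e))); last first.
      by rewrite sum_nat_const leq_mul2r (load c) orbT.
    apply: (@leq_trans (2 * s * \sum_(b in In c) #|b |: clash b c|)).
      by rewrite leq_mul2l leq_card_bigcup orbT.
    rewrite big_distrr /=; apply: leq_sum => b; rewrite inE => /andP[_ /(subsetP (UM b))].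
    rewrite inE cdu => /andP[_ /= clash_lt].
    apply: leq_trans (_ : 2 * s * #|clash b c|.+1 <= _).
      2: by rewrite mulnS leq_add2l ltnW.
    by rewrite leq_mul2l cardsU1 -[leqRHS]add1n leq_add2r leq_b1 orbT.
  have := subset_leq_card sub; have := cardsID (N2 c) (N1 c).
  rewrite (setIidPr _); last by apply/subsetP => d; rewrite inE => /andP[].
  rewrite N1_card; have := e_big; move: card_union.
  rewrite -[2 * s * _]mulnA [2 * (s * _)]mulnCA leq_pmul2l //; lia.
- move=> b c d bud cU cdu; rewrite inE cdu => /andP[_ /forall_inP]; apply.
  by rewrite inE bud cU.
Qed.

End Mixed.

(** The sets [T v] are fixed successively for the vertices that ascend and are
    followed by descending ones, for those that descend and are followed by
    ascending ones, and for all others. *)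
Lemma C4_13_selection : exists T : V -> {set V},
  [/\ forall v, T v \subset N v, forall v, k <= #|T v| &
    forall a b c d, b != d -> ~~ [&& b \in T a, d \in T a, c \in T b & d \in T c]].
Proof.
have [fwd [to_fwd [N1 [hue [goal]]]]] := oriented_selection.
move=> [N1_N N1_type N1_indeg N1_hue N1_same].
have N1_card v := (N1_N v).2.
have [shade [U [N2]]] := up_down_selection to_fwd N1_card N1_indeg.
move=> [UN1 Uk load N2_N1 apart].
set up_down' := up_down fwd to_fwd in Uk load apart.
set down_up' := down_up fwd to_fwd in apart.
have [tone toneP] := fin_all_exists (fun v => popular shade (N2 v)
  (ltac:(by rewrite card_prod card_ord muln_gt0 l0) : 0 < #|{: 'I_l * 'I_l}|)).
pose N3 v := [set u in N2 v | shade u == tone v].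
have N3_card v : k + s * k * s + k * (k * k + k * k).+1 <= #|N3 v|.
  have m0 : 0 < 4 * m by rewrite muln_gt0 /m muln_gt0 l0.
  rewrite -(leq_pmul2l m0) -/e'.
  have := toneP v; rewrite card_prod card_ord -/m -/(N3 v).
  by have := (N2_N1 v).2; rewrite /e; have := k0; nia.
have N3N1 v : N3 v \subset N1 v.
  by apply: subset_trans (N2_N1 v).1; apply/subsetP => u; rewrite inE => /andP[].
pose In c := [set a | up_down' a && (c \in U a)].
(* the ascending arcs into [b] lead back to vertices [a], hence to the other
   elements [d] of [U a], and to the vertices [c] that ascend to [d] *)
pose sib b := \bigcup_(a in In b) \bigcup_(d in U a) In d.
have sib_card b : #|sib b| <= s * k * s.
  apply: leq_trans (leq_card_bigcup _ _) _.
  apply: (@leq_trans (\sum_(a in In b) k * s)); last first.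
    by rewrite sum_nat_const -mulnA leq_mul2r (load b) orbT.
  apply: leq_sum => a; rewrite inE => /andP[/Uk/andP[_ Uak] _].
  apply: leq_trans (leq_card_bigcup _ _) _.
  apply: (@leq_trans (\sum_(d in U a) s)); first by apply: leq_sum => d _; apply: load.
  by rewrite sum_nat_const leq_mul2r Uak orbT.
have avoid_card b : k <= #|N3 b :\: sib b|.
  have := cardsID (sib b) (N3 b); have := subset_leq_card (subsetIr (N3 b) (sib b)).
  by have := sib_card b; have := N3_card b; lia.
have [W W_avoid W_card] := fin_all_exists2 (fun b => subset_of_card (avoid_card b)).
(* when [a] descends to [b] and [d], this is the path from [b] to [d] to exclude *)
pose jump b d := down_up' b && [exists c in W b, up_down' c && (d \in U c)].
have indep a : exists B : {set V}, [/\ B \subset N3 a, k <= #|B| &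
    forall b d, b \in B -> d \in B -> b != d -> ~~ jump b d].
  apply: (@independent_subset _ _ (k * k)); last by have := N3_card a; lia.
  move=> b; pose Uc c := if up_down' c then U c else set0.
  apply: leq_trans (_ : #|\bigcup_(c in W b) Uc c| <= _).
    apply: subset_leq_card; apply/subsetP => d; rewrite !inE => /andP[_ /andP[_]].
    move=> /exists_inP[c cW /andP[cud dU]]; apply/bigcupP; exists c => //.
    by rewrite /Uc cud.
  apply: leq_trans (leq_card_bigcup _ _) _.
  apply: (@leq_trans (\sum_(c in W b) k)); last by rewrite sum_nat_const W_card.
  apply: leq_sum => c _; rewrite /Uc; case: ifPn => [/Uk/andP[]//|_].
  by rewrite cards0.
have [I IP] := fin_all_exists indep.
pose T v := if up_down' v then U v else if down_up' v then W v else I v.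
have T_N1 v : T v \subset N1 v.
  rewrite /T; case: ifP => _ //; case: ifP => _.
    by apply: subset_trans (W_avoid v) (subset_trans (subsetDl _ _) (N3N1 v)).
  by have [IN3 _ _] := IP v; apply: subset_trans IN3 (N3N1 v).
have T_N3 v : ~~ up_down' v -> T v \subset N3 v.
  rewrite /T => /negPf ->; case: ifP => _; last by have [] := IP v.
  exact: subset_trans (W_avoid v) (subsetDl _ _).
exists T; split=> [v|v|a b c d bd].
- exact: subset_trans (T_N1 v) (N1_N v).1.
- rewrite /T; case: ifP => [/Uk/andP[]//|_]; case: ifP => _; first by rewrite W_card.
  by have [] := IP v.
apply/and4P => -[ba da cb dc].
have [ba1 da1] := (subsetP (T_N1 a) b ba, subsetP (T_N1 a) d da).
have [cb1 dc1] := (subsetP (T_N1 b) c cb, subsetP (T_N1 c) d dc).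
have [b_a d_a] := (N1_type _ _ ba1, N1_type _ _ da1).
have [c_b d_c] := (N1_type _ _ cb1, N1_type _ _ dc1).
have [same_b|mixed_b] := eqVneq (fwd b) (to_fwd b).
  have same_c : fwd c = to_fwd c by rewrite -d_c d_a -b_a same_b c_b.
  have := N1_same b c same_b same_c cb1.
  by rewrite -(N1_hue _ _ dc1) (N1_hue _ _ da1) (N1_hue _ _ ba1) eqxx.
have [b_fwd|b_bwd] := boolP (fwd b).
- have b_ud : up_down' b.
    by rewrite /up_down' /up_down; move: mixed_b; rewrite b_fwd; case: (to_fwd b).
  have c_du : down_up' c.
    by rewrite /down_up' /down_up -d_c d_a -b_a b_fwd c_b; move: b_ud => /andP[_ ->].
  have a_ud : ~~ up_down' a by rewrite /up_down' /up_down -b_a b_fwd andbF.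
  have c_ud : ~~ up_down' c.
    by move: c_du => /andP[/negPf c_bwd _]; rewrite /up_down' /up_down c_bwd.
  have cU : c \in U b by move: cb; rewrite /T b_ud.
  have dN2 : d \in N2 c by move: (subsetP (T_N3 c c_ud) d dc); rewrite inE => /andP[].
  have := apart b c d b_ud cU c_du dN2.
  move: (subsetP (T_N3 a a_ud) b ba) (subsetP (T_N3 a a_ud) d da).
  by rewrite !inE => /andP[_ /eqP->] /andP[_ /eqP->]; rewrite eqxx.
- have b_du : down_up' b.
    by rewrite /down_up' /down_up b_bwd; move: mixed_b; rewrite (negPf b_bwd); case: (to_fwd b).
  have b_ud : ~~ up_down' b by rewrite /up_down' /up_down (negPf b_bwd).
  have c_ud : up_down' c.
    by rewrite /up_down' /up_down -d_c d_a -b_a b_bwd c_b andbT; move: b_du => /andP[_ ->].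
  have cW : c \in W b by move: cb; rewrite /T (negPf b_ud) b_du.
  have dU : d \in U c by move: dc; rewrite /T c_ud.
  have [a_ud|a_ud] := boolP (up_down' a).
    have [bU dU'] : b \in U a /\ d \in U a by move: ba da; rewrite /T a_ud.
    move: (subsetP (W_avoid b) c cW); rewrite inE => /andP[/negP + _]; apply.
    by apply/bigcupP; exists a; [|apply/bigcupP; exists d]; rewrite ?inE ?a_ud ?c_ud.
  have a_du : ~~ down_up' a by rewrite /down_up' /down_up -b_a (negPf b_bwd) andbF.
  have [bI dI] : b \in I a /\ d \in I a by move: ba da; rewrite /T (negPf a_ud) (negPf a_du).
  have [_ _ /(_ b d bI dI bd)/negP[]] := IP a.
  by rewrite /jump b_du; apply/exists_inP; exists c; rewrite ?c_ud.
Qed.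

End Transitive.

(** * The four orientations of the 4-cycle *)

Definition o4 k (k4 : k < 4) : 'I_4 := Ordinal k4.

Lemma all_I4 (P : pred 'I_4) :
  [&& P (@o4 0 isT), P (@o4 1 isT), P (@o4 2 isT) & P (@o4 3 isT)] -> forall i, P i.
Proof.
move=> /and4P[P0 P1 P2 P3] [i i4].
by case: i i4 => [|[|[|[|i]]]] i4 //; rewrite (bool_irrelevance i4 isT).
Qed.

(** The four orientations are told apart by the length of a longest walk, which is
    infinite, 3, 2 and 1, respectively. *)
Definition has_walk n (D : digraph) := exists (x : D) (p : seq D), path (@arc D) x p /\ size p = n.

Lemma has_walk_diso n F G : diso F G -> has_walk n F -> has_walk n G.
Proof.
move=> [f [_ f_arc]] [x [p [px pn]]]; exists (f x), (map f p); rewrite size_map; split=> //.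
by rewrite path_map (eq_path (e' := @arc F)).
Qed.

Lemma has_walk_level n m (D : digraph) (lev : D -> nat) : m < n ->
  (forall u v, arc u v -> lev u < lev v <= m) -> ~ has_walk n D.
Proof.
move=> mn lev_arc [x [p [px pn]]].
suff : (p != [::]) ==> (lev x + size p <= m) by rewrite pn; case: p {px} pn => [|y p] /=; lia.
elim: p x px {pn} => //= y p IH x /andP[/lev_arc/andP[xy ym] /IH].
by case: p {IH} => [|z p] /=; lia.
Qed.

Definition arc_list (q : nat) : seq (nat * nat) :=
  match q with
  | 0 => [:: (0, 1); (1, 2); (2, 3); (3, 0)]
  | 1 => [:: (0, 1); (1, 2); (2, 3); (0, 3)]
  | 2 => [:: (0, 1); (0, 3); (1, 2); (3, 2)]
  | _ => [:: (0, 1); (0, 3); (2, 1); (2, 3)]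
  end.

Lemma C4_orientationP (P : nat -> digraph -> Prop) :
  P 0 C4_directed -> P 1 C4_13 -> P 2 C4_22 -> P 3 K22_directed ->
  forall i : 'I_4, P i (C4_orientation i).
Proof. by move=> P0 P1 P2 P3 [[|[|[|[|]]]]]. Qed.

Lemma C4_orientation_inj (i j : 'I_4) : diso (C4_orientation i) (C4_orientation j) -> i = j.
Proof.
have walk : forall i : 'I_4, has_walk (4 - i) (C4_orientation i).
  pose o k (k4 : k < 4) : 'I_4 := Ordinal k4.
  apply: (C4_orientationP (P := fun i D => has_walk (4 - i) D)).
  - by exists (@o 0 isT), [:: @o 1 isT; @o 2 isT; @o 3 isT; @o 0 isT].
  - by exists (@o 0 isT), [:: @o 1 isT; @o 2 isT; @o 3 isT].
  - by exists (@o 0 isT), [:: @o 1 isT; @o 2 isT].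
  - by exists (@o 0 isT), [:: @o 1 isT].
have no_walk : forall j i : 'I_4, i < j -> ~ has_walk (4 - i) (C4_orientation j).
  apply: (C4_orientationP (P := fun j D => forall i : 'I_4, i < j -> ~ has_walk (4 - i) D)).
  - by [].
  - move=> k k1; apply: (@has_walk_level _ 3 C4_13 (fun u : 'I_4 => u)); first by lia.
    by move=> u v; apply/implyP; move: v; apply: all_I4; move: u; apply: all_I4.
  - move=> k k2; apply: (@has_walk_level _ 2 C4_22
      (fun u : 'I_4 => nth 0 [:: 0; 1; 2; 1] u)); first by lia.
    by move=> u v; apply/implyP; move: v; apply: all_I4; move: u; apply: all_I4.
  - move=> k k3; apply: (@has_walk_level _ 1 K22_directed
      (fun u : 'I_4 => nth 0 [:: 0; 1; 0; 1] u)); first by lia.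
    by move=> u v; apply/implyP; move: v; apply: all_I4; move: u; apply: all_I4.
move=> iso_ij; apply/val_inj; case: (ltngtP i j) => // lt_ij.
- by case: (no_walk j i lt_ij); apply: has_walk_diso iso_ij (walk i).
- by case: (no_walk i j lt_ij); apply: has_walk_diso (diso_sym iso_ij) (walk j).
Qed.

Lemma orientation_of_diso (T : finType) (g : rel T) F G :
  diso F G -> orientation_of g G -> orientation_of g F.
Proof.
move=> [f [f_bij f_arc]] [h [h_bij h_arc]]; exists (h \o f); split.
  exact: bij_comp.
by move=> u v; rewrite /= -!f_arc.
Qed.

Lemma C4_orientation_of (i : 'I_4) : orientation_of C4 (C4_orientation i).
Proof.
by apply: (C4_orientationP (P := fun _ => orientation_of C4)) i;
  (exists (fun x : 'I_4 => x); split; first by exists id);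
  move=> u v; apply: (andPP eqP idP); move: v; apply: all_I4; move: u; apply: all_I4.
Qed.

(** An orientation of the 4-cycle is encoded by the list [e] that tells which of the
    edges [{i, i + 1}] are oriented from [i] to [i + 1]; this reduces the
    classification to a finite computation. *)
Definition oriented_arc (e : seq bool) (i j : nat) :=
  if j == i.+1 %% 4 then nth false e i else (i == j.+1 %% 4) && ~~ nth false e j.

Definition relabels (e : seq bool) (q : nat) (p : seq nat) :=
  all (fun i => all (fun j =>
    oriented_arc e i j == ((nth 0 p i, nth 0 p j) \in arc_list q)) (iota 0 4)) (iota 0 4).

Lemma relabels_exists e : size e = 4 ->
  exists2 q, q < 4 & exists2 p, perm_eq p (iota 0 4) & relabels e q p.
Proof.
suff : has (fun q => has (relabels e q) (permutations (iota 0 4))) (iota 0 4) || (size e != 4).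
  move=> + e4; rewrite e4 orbF => /hasP[q]; rewrite mem_iota => q4 /hasP[p].
  by rewrite mem_permutations => p_perm ep; exists q => //; exists p.
case: e => [|e0 [|e1 [|e2 [|e3 [|? ?]]]]]; rewrite ?orbT //.
by case: e0; case: e1; case: e2; case: e3; vm_compute.
Qed.

Lemma orientation_diso F : orientation_of C4 F -> exists i, diso F (C4_orientation i).
Proof.
move=> [f [f_bij f_arc]]; have [g fK gK] := f_bij.
pose e := [seq arc (g i) (g (ordS i)) | i <- enum 'I_4].
have e4 : size e = 4 by rewrite size_map size_enum_ord.
have e_nth (i : 'I_4) : nth false e i = arc (g i) (g (ordS i)).
  by rewrite (nth_map i) ?size_enum_ord // nth_ord_enum.
have arcE u v : arc u v = oriented_arc e (f u) (f v).
  have [adj anti] := f_arc u v; rewrite /oriented_arc.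
  have succ (i j : 'I_4) : (val j == i.+1 %% 4) = (j == ordS i) by [].
  rewrite !succ; case: eqP => [vu|vu]; first by rewrite e_nth -vu !fK.
  case: eqP => [uv|uv] /=.
    rewrite e_nth -uv !fK; move: adj anti; rewrite /C4 -uv eqxx orbT.
    by case: (arc u v); case: (arc v u).
  by move: adj; rewrite /C4 (negPf (introN eqP vu)) (negPf (introN eqP uv)); case: (arc u v).
have [q q4 [p p_perm /allP ep]] := relabels_exists e4.
have p4 : size p = 4 by rewrite (perm_size p_perm).
have p_lt i : i < 4 -> nth 0 p i < 4.
  by move=> i4; have := mem_nth 0 (_ : i < size p); rewrite p4 (perm_mem p_perm) mem_iota; apply.
pose r (u : F) : 'I_4 := Ordinal (p_lt (f u) (ltn_ord _)).
have r_bij : bijective r.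
  have r_inj : injective r.
    move=> u v /(congr1 val) /eqP; rewrite /= nth_uniq ?p4 // ?(perm_uniq p_perm) ?iota_uniq //.
    by move=> /eqP/val_inj/(can_inj fK).
  by apply: inj_card_bij => //; rewrite card_ord (bij_eq_card f_bij) card_ord.
have r_arc u v : ((val (r u), val (r v)) \in arc_list q) = arc u v.
  have in_iota (i : 'I_4) : val i \in iota 0 4 by rewrite mem_iota ltn_ord.
  by rewrite arcE; have /allP/(_ _ (in_iota (f v)))/eqP-> := ep _ (in_iota (f u)).
exists (Ordinal q4); case: q q4 {ep} r_arc => [|[|[|[|]]]] // q4 r_arc; by exists r.
Qed.

Lemma height_diso F G : diso F G ->
  (exists h : G -> int, height_function h) -> exists h : F -> int, height_function h.
Proof. by move=> [f [_ f_arc]] [h hP]; exists (h \o f) => u v uv; apply: hP; rewrite f_arc. Qed.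

Lemma C4_directed_no_height : ~ exists h : C4_directed -> int, height_function h.
Proof.
move=> [h hP]; pose o k (k4 : k < 4) : C4_directed := Ordinal k4.
have := hP (@o 0 isT) (@o 1 isT) isT; have := hP (@o 1 isT) (@o 2 isT) isT.
have := hP (@o 2 isT) (@o 3 isT) isT; have := hP (@o 3 isT) (@o 0 isT) isT.
lia.
Qed.

Lemma C4_13_no_height : ~ exists h : C4_13 -> int, height_function h.
Proof.
move=> [h hP]; pose o k (k4 : k < 4) : C4_13 := Ordinal k4.
have := hP (@o 0 isT) (@o 1 isT) isT; have := hP (@o 1 isT) (@o 2 isT) isT.
have := hP (@o 2 isT) (@o 3 isT) isT; have := hP (@o 0 isT) (@o 3 isT) isT.
lia.
Qed.

Lemma C4_22_height : exists h : C4_22 -> int, height_function h.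
Proof.
exists (fun u : 'I_4 => Posz (nth 0 [:: 0; 1; 2; 1] u)) => u v.
by apply/(implyPP idP eqP); move: v; apply: all_I4; move: u; apply: all_I4.
Qed.

Lemma K22_height : exists h : K22_directed -> int, height_function h.
Proof.
exists (fun u : 'I_4 => Posz (nth 0 [:: 0; 1; 0; 1] u)) => u v.
by apply/(implyPP idP eqP); move: v; apply: all_I4; move: u; apply: all_I4.
Qed.

(** * Conclusion *)

Lemma C4_directed_avoidable : avoidable C4_directed.
Proof.
apply: avoidable_selection => k _; have [d sel] := no_directed_C4 k.
exists d => V N _ N_card; have [T [TN kT noC]] := sel V N N_card.
exists T; split=> // -[f [f_inj f_arc]].
have /negP := noC (f (@o4 0 isT)) (f (@o4 1 isT)) (f (@o4 2 isT)) (f (@o4 3 isT))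
  (etrans (map_inj_uniq f_inj [:: @o4 0 isT; @o4 1 isT; @o4 2 isT; @o4 3 isT]) isT).
by apply; apply/and4P; split; apply: f_arc.
Qed.

Lemma C4_13_avoidable : avoidable C4_13.
Proof.
apply: avoidable_selection => k k0; eexists => V N N_irr N_card.
have [T [TN kT noC]] := C4_13_selection k0 N_irr N_card.
exists T; split=> // -[f [f_inj f_arc]].
have bd : f (@o4 1 isT) != f (@o4 3 isT) by rewrite (inj_eq f_inj).
have /negP := noC (f (@o4 0 isT)) _ (f (@o4 2 isT)) _ bd.
by apply; apply/and4P; split; apply: f_arc.
Qed.

Lemma avoidable_iff_no_height (i : 'I_4) : avoidable (C4_orientation i) <->
  ~ exists h : C4_orientation i -> int, height_function h.
Proof.
apply: (C4_orientationP (P := fun _ D => avoidable D <->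
  ~ exists h : D -> int, height_function h)) i; split=> //.
- by move=> _; exact: C4_directed_no_height.
- by move=> _; exact: C4_directed_avoidable.
- by move=> _; exact: C4_13_no_height.
- by move=> _; exact: C4_13_avoidable.
- by move=> /C4_22_unavoidable.
- by move=> /(_ C4_22_height).
- by move=> /K22_unavoidable.
- by move=> /(_ K22_height).
Qed.

Theorem theorem1p2 :
  (forall F : digraph, orientation_of C4 F ->
     (avoidable F <-> ~ exists h : F -> int, height_function h)) /\
  (* the four digraphs are all the orientations of C4 up to isomorphism *)
  ((forall F : digraph, orientation_of C4 F <->
      exists i : 'I_4, diso F (C4_orientation i)) /\
   (forall i j : 'I_4,
      diso (C4_orientation i) (C4_orientation j) -> i = j)) /\
  (avoidable C4_directed /\ avoidable C4_13 /\
   ~ avoidable C4_22 /\ ~ avoidable K22_directed).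
Proof.
split; last split.
- move=> F /orientation_diso[i isoF]; have [avH Hav] := avoidable_iff_no_height i; split.
  + move=> /(avoidable_diso isoF)/avH noh /(height_diso (diso_sym isoF)).
    exact: noh.
  + move=> noh; apply: avoidable_diso (diso_sym isoF) _; apply: Hav.
    by move=> /(height_diso isoF).
- split; last exact: C4_orientation_inj.
  move=> F; split; first exact: orientation_diso.
  by move=> [i isoF]; apply: orientation_of_diso isoF (C4_orientation_of i).
- split; first exact: C4_directed_avoidable.
  split; first exact: C4_13_avoidable.
  by split; [exact: C4_22_unavoidable | exact: K22_unavoidable].
Qed.
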